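(* There exists $n_0$ such that for every integer $n\ge n_0$ and every positive integer $r<\sqrt[5]{\ln n}$ the following holds: every $n$-uniform hypergraph $H=(V,E)$ with $$|E|\le 0.01\left(\frac{n}{\ln n}\right)^{\frac{r-1}{r}}r^{n-1}$$ and with $|V|$ divisible by $r$ admits an equitable $r$-coloring.
   Context: A hypergraph $H=(V,E)$ is $n$-uniform if every edge is an $n$-element subset of $V$. A coloring of $V$ with colors $\{1,\dots,r\}$ is proper if no edge is monochromatic (i.e. no edge has all its vertices of the same color). A coloring is an equitable $r$-coloring if it is a proper coloring with $r$ colors in which the sizes of any two color classes differ by at most one. *)

(* Defs.v *)
From mathcomp Require Import all_boot.
From Stdlib Require Import Reals.
Set Implicit Arguments. Unset Strict Implicit. Unset Printing Implicit Defensive.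

(* A hypergraph on a finite vertex type V is given by its edge set E. *)
Definition uniform (V : finType) (n : nat) (E : {set {set V}}) : Prop :=
  forall e, e \in E -> #|e| = n.

Definition proper_coloring (V : finType) (r : nat) (E : {set {set V}})
    (f : V -> 'I_r) : Prop :=
  forall e, e \in E -> ~ (exists c : 'I_r, forall v, v \in e -> f v = c).

Definition color_class (V : finType) (r : nat) (f : V -> 'I_r) (i : 'I_r) : {set V} :=
  [set v | f v == i].

Definition equitable_coloring (V : finType) (r : nat) (E : {set {set V}})
    (f : V -> 'I_r) : Prop :=
  proper_coloring E f /\
  forall i j : 'I_r, #|color_class f i| <= #|color_class f j| + 1.

(* Main.v *)
Require Import Defs.
From mathcomp Require Import all_boot all_order all_algebra all_fingroup.
From mathcomp Require Import zify.
From Stdlib Require Znat.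
Set Implicit Arguments. Unset Strict Implicit. Unset Printing Implicit Defensive.

(** Write N = |V| and y = ln n.  If N <= r n^2 / (4 y), a uniformly random
    balanced coloring works by the first moment method, because sampling without
    replacement gains the factor exp(-(r-1) n^2 / (2N)).

    If N is larger, give the vertices independent uniform weights in [0, K) and
    draw an arc u -> v when u is the first and v the last vertex of some edge.  It
    suffices to color this digraph properly with equal classes.  As in the
    Cherkashin-Kozik argument, with positive probability no edge spans much less
    than K/r and there is no directed walk of r arcs: the lengths of the r edges of
    such a walk add up to at most K, so the product of the lengths is at most
    (K/r)^r, and the endpoints range over a simplex of side about K y / n.
    Cut the order into r blocks of roughly N/r vertices and color v in block j by j,
    except that v drops to j-1 if a walk of r-j+1 arcs starts at v, and rises to j+1
    if no walk of r-j arcs starts at v but, for some k, a walk of k arcs that begins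
    no earlier than block j-k+1 ends at v.  Moving one cut past a vertex changes the
    number of vertices of color at most j by at most one, so the cuts can be chosen
    one after the other to make all classes equal, as long as few vertices change
    color; these are counted by walks of fewer than r arcs, whose expected number
    is at most n exp(- y / r) up to lower-order factors, while fluctuations of the
    weights allow windows of about (r N)^(1/2) >= r n / (2 y^(1/2)) vertices around
    the cuts. *)

(** * Balanced colorings of digraphs without long walks *)

Section Walks.
Variables (V : finType) (step : rel V).

Fixpoint walk (k : nat) (u v : V) : bool :=
  if k is k'.+1 then [exists w, walk k' u w && step w v] else u == v.

Definition starts_walk (k : nat) (u : V) : bool := [exists v, walk k u v].

Lemma walkSr k u w v : walk k u w -> step w v -> walk k.+1 u v.
Proof. by move=> uw wv; apply/existsP; exists w; apply/andP. Qed.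

Lemma walkSl k u w v : step u w -> walk k w v -> walk k.+1 u v.
Proof.
elim: k v => [|k IH] v suw /=.
  by move/eqP=> <-; apply/existsP; exists u; rewrite eqxx.
case/existsP=> x /andP[wx xv]; apply/existsP; exists x; rewrite xv andbT.
exact: IH.
Qed.

Lemma starts_walkS k u v : step u v -> starts_walk k v -> starts_walk k.+1 u.
Proof. by move=> suv /existsP[w wk]; apply/existsP; exists w; apply: walkSl wk. Qed.

Lemma starts_walkW k u : starts_walk k.+1 u -> starts_walk k u.
Proof. by case/existsP=> w /existsP[x /andP[wk _]]; apply/existsP; exists x. Qed.

Lemma starts_walk0 u : starts_walk 0 u.
Proof. by apply/existsP; exists u => /=. Qed.

End Walks.

(** [F] may fall by any amount but rises by at most one per step, so no value between [F a] and
    [F b] is skipped. It is applied with [F x] the number of vertices receiving one of the first [j]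
    colors when cut [j] stands at [x]. *)
Lemma discrete_ivt (F : nat -> nat) a b c :
  (forall x, F x.+1 <= (F x).+1) -> a <= b -> F a <= c -> c <= F b ->
  exists2 x, a <= x <= b & F x = c.
Proof.
move=> Fs; elim: b => [|b IH] ab Fa Fb.
  by exists 0; move: ab; rewrite leqn0 => /eqP a0; rewrite a0 in Fa *; lia.
case: (leqP c (F b)) => cFb; last first.
  by exists b.+1; [rewrite ab leqnn | have := Fs b; lia].
case: (leqP a b) => ab'.
  by have [x xb Fx] := IH ab' Fa cFb; exists x => //; lia.
have eab : a = b.+1 by lia.
by exists a; [lia | rewrite eab in Fa *; lia].
Qed.

(** * Equal color classes by sliding cuts *)

Section BalancedColoring.
(** [g] is the position in the order, [M] the class size, and [[lo j, hi j]] the window in which the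
    cut between blocks [j] and [j + 1] may be placed. *)
Variables (V : finType) (g : V -> nat) (step : rel V) (r M : nat) (lo hi : nat -> nat).
Hypothesis g_inj : injective g.
Hypothesis step_lt : forall u v, step u v -> g u < g v.
Hypothesis r_gt0 : 0 < r.
Hypothesis card_V : #|V| = r * M.
Hypothesis lo0 : lo 0 = 0.
Hypothesis lt_hi : forall v, g v < hi r.
Hypothesis lo_le_hi : forall j, lo j <= hi j.
Hypothesis hi_le_lo : forall j, hi j <= lo j.+1.
Hypothesis no_full_walk : forall v, ~~ starts_walk step r v.
Hypothesis no_long_walk : forall i k u v, 0 < k -> i + k <= r ->
  walk step k.+1 u v -> lo i <= g u -> g v < hi (i + k) -> False.
(** [few_starts] and [few_ends] make the count at cut [j] at most [j * M] at the lower end of its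
    window and at least [j * M] at the upper end, whatever the earlier cuts are. *)
Hypothesis few_starts : forall j, 0 < j < r ->
  #|[set v | g v < lo j]| + #|[set v | (lo j <= g v) && starts_walk step (r - j) v]|
    <= j * M.
Hypothesis few_ends : forall j, 0 < j < r ->
  j * M + #|[set v | (g v < hi j) && [exists k : 'I_j.+1, exists u,
      [&& 0 < k, walk step k u v & lo (j - k) <= g u]]]|
    <= #|[set v | g v < hi j]|.

(** The condition [0 < k] makes this depend only on the cuts before [b j], so cut [j] can be chosen
    after them. *)
Definition ends_walk (b : nat -> nat) (j : nat) (v : V) : bool :=
  [exists k : 'I_j.+1, exists u, [&& 0 < k, walk step k u v & b (j - k) <= g u]].

Definition below_cut (b : nat -> nat) (j x : nat) (v : V) : bool :=
  if g v < x then ~~ [&& b j.-1 <= g v, ~~ starts_walk step (r - j) v & ends_walk b j v]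
  else starts_walk step (r - j) v.

Local Notation low b j := (below_cut b j (b j)).

Lemma eq_ends_walk b b' j v :
  (forall i, i < j -> b i = b' i) -> ends_walk b j v = ends_walk b' j v.
Proof.
move=> eb; apply: eq_existsb => k; apply: eq_existsb => u.
by case: (posnP k) => //= k0; rewrite eb //; have := ltn_ord k; lia.
Qed.

Lemma eq_below_cut b b' j x v : 0 < j ->
  (forall i, i < j -> b i = b' i) -> below_cut b j x v = below_cut b' j x v.
Proof.
by move=> j0 eb; rewrite /below_cut (eq_ends_walk v eb) eb //; lia.
Qed.

Lemma card_below_cutS b j x :
  #|[set v | below_cut b j x.+1 v]| <= #|[set v | below_cut b j x v]|.+1.
Proof.
have sub : [set v | below_cut b j x.+1 v] \subset
    [set v | below_cut b j x v] :|: [set v | g v == x].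
  apply/subsetP => v; rewrite !inE /below_cut ltnS.
  by case: (ltngtP (g v) x) => // _; rewrite ?orbF ?orbT // => ->.
have g1 : #|[set v | g v == x]| <= 1.
  apply/card_le1_eqP => u v; rewrite !inE => /eqP gu /eqP gv.
  by apply: g_inj; rewrite gu gv.
have := subset_leq_card sub; rewrite cardsU; lia.
Qed.

Lemma exists_cuts J : J < r -> exists2 b : nat -> nat, b 0 = 0 &
  forall j, 0 < j <= J -> lo j <= b j <= hi j /\ #|[set v | low b j v]| = j * M.
Proof.
elim: J => [|J IH] Jr; first by exists (fun=> 0) => // j; lia.
have [b b0 bP] := IH (ltnW Jr).
have lob i : i <= J -> lo i <= b i.
  by case: i => [|i] iJ; [rewrite lo0 | have [/andP[]] := bP i.+1 iJ].
have [] := @discrete_ivt (fun x => #|[set v | below_cut b J.+1 x v]|)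
  (lo J.+1) (hi J.+1) (J.+1 * M).
- by move=> x; apply: card_below_cutS.
- exact: lo_le_hi.
- apply: leq_trans (few_starts (j := J.+1) _); last by lia.
  apply: leq_trans (leq_card_setU _ _); apply: subset_leq_card.
  apply/subsetP => v; rewrite !inE /below_cut.
  by case: ltnP.
(* The vertices below [hi J.+1] that may rise are added on both sides. Replacing the earlier cuts
   [b i] by [lo i] only enlarges this set, and its size is then controlled by [few_ends]. *)
- rewrite -(leq_add2r #|[set v | (g v < hi J.+1) && [exists k : 'I_J.+2, exists u,
      [&& 0 < k, walk step k u v & lo (J.+1 - k) <= g u]]]|).
  apply: leq_trans (few_ends _) _; first by lia.
  apply: leq_trans (leq_card_setU _ _); apply: subset_leq_card.
  apply/subsetP => v; rewrite !inE /below_cut => gv; rewrite gv /=.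
  rewrite -implybE; apply/implyP => /and3P[_ _].
  case/existsP=> k /existsP[u /and3P[k0 wk bu]].
  apply/existsP; exists k; apply/existsP; exists u; rewrite k0 wk /=.
  by apply: leq_trans (lob _ _) bu; have := ltn_ord k; lia.
move=> x xb cx.
pose b' i := if i == J.+1 then x else b i.
have eb i : i < J.+1 -> b' i = b i by rewrite /b'; case: eqP => //; lia.
exists b' => [|j /andP[j0 jJ]]; first by rewrite eb.
case: (ltngtP j J.+1) => [jlt||->]; last 2 first.
- lia.
- rewrite {1 2}/b' eqxx; split=> //; rewrite -cx; apply: eq_card => v.
  by rewrite !inE {2}/b' eqxx; apply: eq_below_cut.
rewrite eb //; have [] := bP j; first by lia.
move=> lh cj; split=> //; rewrite -cj; apply: eq_card => v; rewrite !inE.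
by apply: eq_below_cut => // i ij; apply: eb; lia.
Qed.

(** By monotonicity the failures of [a] form an initial segment and the sum is its length, cut off
    at [m]. This turns the nested sets of low vertices into a color number. *)
Lemma sum_count_prefix (a : nat -> bool) m :
  (forall j, a j -> a j.+1) ->
  forall i, i <= m -> (\sum_(j < m) ~~ a j <= i) = (i == m) || a i.
Proof.
move=> am; have amono i j : i <= j -> a i -> a j.
  move=> /subnK <-; elim: (j - i) => //= d IH ai; exact/am/IH.
move=> i im.
have bound : \sum_(j < m) ~~ a j <= m.
  by rewrite -[X in _ <= X]card_ord -sum1_card leq_sum // => j _; case: (a j).
case: eqVneq => [->|nim] /=; first by rewrite bound.
have {nim}im : i < m by lia.
rewrite -(big_mkord xpredT (fun j => (~~ a j : nat))).
rewrite (@big_cat_nat _ _ _ i) //=; last by lia.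
case ai: (a i).
- rewrite [X in _ + X]big_nat_cond [X in _ + X]big1; last first.
    by move=> j; rewrite andbT => /andP[ij _]; rewrite (amono _ _ ij ai).
  rewrite addn0 -[X in _ <= X]subn0 -[i - 0]muln1 -sum_nat_const_nat.
  by apply: leq_sum => j _; case: (a j).
- apply/negbTE; rewrite -ltnNge [X in _ + X]big_ltn // ai.
  suff -> : \sum_(0 <= j < i) ~~ a j = i by lia.
  rewrite -[RHS]subn0 -[i - 0]muln1 -sum_nat_const_nat.
  rewrite [LHS]big_nat_cond [RHS]big_nat_cond; apply: eq_bigr => j.
  rewrite andbT => /andP[_ ji].
  case aj: (a j) => //; move: ai; rewrite (amono _ _ (ltnW ji) aj); by [].
Qed.

(** The color of a vertex is the number of cuts for which it is not low, so class sizes are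
    differences of consecutive multiples of [M]. If an arc had equally colored ends, these would be
    low for the same cuts; the position and walks of the head then lead to a contradiction in each
    case. *)
Lemma balanced_walk_coloring : exists c : V -> 'I_r,
  (forall i, #|[set v | c v == i]| = M) /\ (forall u v, step u v -> c u != c v).
Proof.
have [b' b'0 b'P] := exists_cuts (J := r.-1) ltac:(lia).
(* The last cut is put above all vertices, so every vertex lies in one of the [r] blocks. *)
pose b j := if j < r then b' j else hi r.
have eb j : j < r -> b j = b' j by rewrite /b => ->.
have br j : r <= j -> b j = hi r by rewrite /b ltnNge => ->.
have b0 : b 0 = 0 by rewrite eb.
have bP j : 0 < j < r -> lo j <= b j <= hi j /\ #|[set v | low b j v]| = j * M.
  move=> /andP[j0 jr]; rewrite eb //; have [] := b'P j; first by lia.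
  move=> lh cj; split=> //; rewrite -cj; apply: eq_card => v; rewrite !inE.
  by apply: eq_below_cut => // i ij; apply: eb; lia.
have lob i : i <= r -> lo i <= b i.
  case: i => [|i] ir; first by rewrite lo0.
  case: (ltngtP i.+1 r) => irr; last 2 first.
  - lia.
  - by rewrite br -?irr ?lo_le_hi.
  by have [/andP[]] := bP i.+1 irr.
have bhi i : 0 < i -> i <= r -> b i <= hi i.
  move=> i0 ir; case: (ltngtP i r) => irr; last 2 first.
  - lia.
  - by rewrite irr br.
  by have [|/andP[]] := bP i; first lia.
have bS i : i < r -> b i <= b i.+1.
  move=> ir; case: (posnP i) => [->|i0]; first by rewrite b0.
  by apply: leq_trans (bhi _ i0 (ltnW ir)) (leq_trans (hi_le_lo i) (lob _ ir)).
have bmono i j : i <= j -> j <= r -> b i <= b j.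
  move=> /subnK <-; elim: (j - i) => //= d IH dr.
  by apply: leq_trans (IH _) (bS _ _); lia.
pose low j v := below_cut b j (b j) v.
have lowS j v : 0 < j -> j.+1 < r -> low j v -> low j.+1 v.
  move=> j0 jr; rewrite /low /below_cut /=.
  have HW : starts_walk step (r - j) v -> starts_walk step (r - j.+1) v.
    rewrite (_ : r - j = (r - j.+1).+1); last by lia.
    exact: starts_walkW.
  have := bS j (ltnW jr).
  case: (ltnP (g v) (b j)) => gb bb; last first.
    by move/HW=> ->; rewrite andbF; case: ifP.
  by move=> _; rewrite (leq_trans gb bb).
(* Index [j] stands for cut [j + 1]; the first disjunct covers the indices without a cut and keeps
   [a v] monotone everywhere. *)
pose a v j := (r <= j.+1) || low j.+1 v.
have aS v j : a v j -> a v j.+1.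
  rewrite /a; case: (leqP r j.+1) => rj; first by rewrite leqW.
  by case: (leqP r j.+2) => //= rj2; apply: lowS.
pose cn v := \sum_(j < r.-1) ~~ a v j.
have cnP v i : i <= r.-1 -> (cn v <= i) = (i == r.-1) || low i.+1 v.
  move=> ir; rewrite /cn (sum_count_prefix (aS v)) // /a.
  by case: eqVneq => //= ne; rewrite [r <= _]leqNgt (_ : i.+1 < r) //; lia.
have cn_lt v : cn v < r.
  by have := cnP v r.-1 (leqnn _); rewrite eqxx; lia.
pose c v := Ordinal (cn_lt v).
exists c; split=> [i|u v suv].
  have cum j : j < r -> #|[set v | cn v <= j]| = j.+1 * M.
    move=> jr; case: (eqVneq j r.-1) => [ej|nj].
      rewrite (_ : [set v | _] = setT) ?cardsT ?card_V ?ej ?prednK //.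
      by apply/setP => v; rewrite !inE; have := cn_lt v; lia.
    have [|_ <-] := bP j.+1; first by lia.
    apply: eq_card => v; rewrite !inE cnP; last by lia.
    by rewrite (negbTE nj).
  have := cum i (ltn_ord i); case: (posnP i) => i0.
    rewrite i0 mul1n => <-.
    by apply: eq_card => v; rewrite !inE -val_eqE /= i0 leqn0.
  have := cum i.-1 (leq_ltn_trans (leq_pred _) (ltn_ord i)).
  rewrite prednK // => c1 c2.
  have : #|[set v | cn v <= i]| = #|[set v | cn v <= i.-1]| + #|[set v | c v == i]|.
    rewrite -cardsUI (_ : _ :&: _ = set0) ?cards0 ?addn0.
      by apply: eq_card => v; rewrite !inE -val_eqE /=; lia.
    by apply/setP => v; rewrite !inE -val_eqE /=; lia.
  rewrite c1 c2 mulSn; lia.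
apply/negP => /eqP cuv.
have ecn : cn u = cn v by have := congr1 val cuv.
have elow j : 0 < j < r -> low j u = low j v.
  move=> /andP[j0 jr]; have := cnP u j.-1; have := cnP v j.-1.
  rewrite ecn prednK // => -> //; last by lia.
  by rewrite (_ : (j.-1 == r.-1) = false) /=; [move->=> //; lia | lia].
have guv := step_lt suv.
(* [j] is the block of [v], with blocks numbered from 1. *)
have [j /andP[j0 jr] /andP[bj gj]] : exists2 j, 0 < j <= r & b j.-1 <= g v < b j.
  have ex : exists j, g v < b j by exists r; rewrite br.
  case: (ex_minnP ex) => j gj jmin; exists j.
    by rewrite lt0n; apply/andP; split; [apply/eqP => j0; rewrite j0 b0 in gj | apply: jmin; rewrite br].
  rewrite gj andbT leqNgt; apply/negP => /jmin.
  by case: j gj {jmin} => [|j] /=; [rewrite b0 | lia].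
have HS k : starts_walk step k v -> starts_walk step k.+1 u := starts_walkS suv.
have lowu i : 0 < i < r -> starts_walk step (r - i) u -> low i u.
  by move=> _ Hu; rewrite /low /below_cut Hu andbF; case: ifP.
have lowv i : 0 < i < j -> low i v = starts_walk step (r - i) v.
  move=> /andP[i0 ij]; rewrite /low /below_cut ltnNge.
  by rewrite (leq_trans _ bj) //; apply: bmono; lia.
(* Here [v] drops. Since [u] starts a walk one arc longer, it is low for cut [j - 2], and so is [v].
   Then [v] starts a walk of [r - j + 2] arcs confined to the [r - j + 1] blocks from [j] on. For
   [j <= 2] there would be a walk of [r] arcs. *)
case HA : (starts_walk step (r - j).+1 v).
  have j1 : 1 < j.
    rewrite ltnNge; apply/negP => j1; have ej : j = 1 by lia.
    by move: (no_full_walk v); rewrite -(_ : (r - j).+1 = r) ?HA //; lia.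
  have j2 : 2 < j.
    rewrite ltnNge; apply/negP => j2'; have ej : j = 2 by lia.
    by move: (HS _ HA); apply/negP; rewrite (_ : (r - j).+2 = r) ?no_full_walk //; lia.
  have Lu : low j.-2 u by apply: lowu; [lia | rewrite (_ : r - j.-2 = (r - j).+2); [exact: HS | lia]].
  move: Lu; rewrite elow; last by lia.
  rewrite lowv; last by lia.
  rewrite (_ : r - j.-2 = (r - j).+2); last by lia.
  case/existsP=> w wk.
  apply: (no_long_walk (i := j.-1) (k := (r - j).+1) _ _ wk) => //; first by lia.
    by apply: leq_trans (lob _ _) bj; lia.
  by rewrite (_ : j.-1 + _ = r) //; lia.
have lowvF : 1 < j -> low j.-1 v = false.
  move=> j1; rewrite lowv; last by lia.
  by rewrite (_ : r - j.-1 = (r - j).+1) //; lia.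
(* Here [v] is not low for cut [j - 1], while [u] starts a walk of [r - j + 1] arcs and is. *)
case HB : (starts_walk step (r - j) v).
  have Hu := HS _ HB.
  case: (ltnP 1 j) => j1; last first.
    by move: (no_full_walk u); rewrite -(_ : (r - j).+1 = r) ?Hu //; lia.
  have Lu : low j.-1 u by apply: lowu; [lia | rewrite (_ : r - j.-1 = (r - j).+1) //; lia].
  by move: Lu; rewrite elow ?lowvF //; lia.
have jr' : j < r.
  by move: HB; rewrite ltn_neqAle jr andbT; case: eqP => // ->; rewrite subnn starts_walk0.
(* Here [v] rises past cut [j], hence so does [u]. The walk of [k] arcs that makes [u] rise,
   prolonged to [v], has [k + 1] arcs within [k] blocks. *)
case HC : (ends_walk b j v).
  have Lv : low j v = false by rewrite /low /below_cut gj bj HB HC.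
  have : low j u = false by rewrite elow //; lia.
  rewrite /low /below_cut (ltn_trans guv gj) => /negbT; rewrite negbK.
  case/and3P=> _ _ /existsP[k /existsP[w /and3P[k0 wk bw]]].
  have kj := ltn_ord k.
  apply: (no_long_walk (i := j - k) (k := k) (u := w) (v := v)) => //.
  - lia.
  - exact: walkSr wk suv.
  - by apply: leq_trans (lob _ _) bw; lia.
  - by rewrite subnK; [apply: leq_trans gj (bhi _ _ _) | lia].
(* Now [v] neither drops nor rises. If [u] is in block [j] too, the single arc from [u] is already a
   walk that would make [v] rise. *)
case: (leqP (b j.-1) (g u)) => bu.
  have lt1 : 1 < j.+1 by lia.
  apply: (elimF idP HC); apply/existsP; exists (Ordinal lt1).
  apply/existsP; exists u; rewrite /= subn1 bu andbT.
  exact: (walkSr (k := 0) (eqxx u) suv).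
have j1 : 1 < j by case: j bu {bj gj j0 jr jr' HA HB HC lowv lowvF} => [|[|]] //=; rewrite b0.
(* Now [u] lies below cut [j - 1] without being low for it, so it rose because of some walk;
   prolonged by the arc, this walk would make [v] rise. *)
have : low j.-1 u = false by rewrite elow ?lowvF //; lia.
rewrite /low /below_cut bu => /negbT; rewrite negbK.
case/and3P=> _ _ /existsP[k /existsP[w /and3P[k0 wk bw]]].
have kj := ltn_ord k.
have kj2 : k.+1 < j.+1 by lia.
apply: (elimF idP HC); apply/existsP; exists (Ordinal kj2).
apply/existsP; exists w; apply/and3P; split=> //.
  exact: walkSr wk suv.
by rewrite /= (_ : j - k.+1 = j.-1 - k) //; lia.
Qed.

End BalancedColoring.

(** * Counting weight functions *)

Lemma card_family_prod (I J : finType) (F : I -> {set J}) :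
  #|[set f : {ffun I -> J} | [forall i, f i \in F i]]| = \prod_i #|F i|.
Proof.
transitivity #|family (fun i => [pred j in F i])|.
  by apply: eq_card => f; rewrite !inE; apply: eq_forallb.
rewrite card_family foldrE big_map big_enum /=.
by apply: eq_bigr => i _; apply: eq_card.
Qed.

Lemma card_ord_interval K a b :
  #|[set y : 'I_K | a <= y <= b]| <= (b - a).+1.
Proof.
case: (leqP a b) => ab; last first.
  by rewrite (_ : [set y : 'I_K | _] = set0) ?cards0 //; apply/setP => y; rewrite !inE; lia.
rewrite cardE -(size_map val) -[(b - a).+1](size_iota a).
apply: uniq_leq_size; first by rewrite map_inj_uniq ?enum_uniq //; apply: val_inj.
move=> x /mapP[y]; rewrite mem_enum inE => yab ->; rewrite mem_iota /=; lia.
Qed.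

Lemma sum_mem_card (I T : finType) (B : I -> {set T}) (U : {set T}) :
  (forall i, B i \subset U) ->
  (forall u i j, u \in B i -> u \in B j -> i = j) -> \sum_i #|B i| <= #|U|.
Proof.
move=> BU Bdis; under eq_bigr do rewrite -sum1_card big_mkcond.
rewrite exchange_big /= -sum1_card [X in _ <= X]big_mkcond /=.
apply: leq_sum => u _; case uU: (u \in U); last first.
  by rewrite big1 // => i _; case: ifP => // /(subsetP (BU i)); rewrite uU.
case: (pickP (fun i => u \in B i)) => [i uBi|no]; last first.
  by rewrite big1 // => i _; rewrite no.
rewrite (bigD1 i) //= big1 ?addn0; first by case: ifP.
by move=> j ji; case: ifP => // uBj; rewrite (Bdis _ _ _ uBj uBi) eqxx in ji.
Qed.

Lemma leq_expl a b k : a <= b -> a ^ k <= b ^ k.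
Proof. by case: k => // k ab; rewrite leq_exp2r. Qed.

Lemma agm_nat k (F : 'I_k -> nat) : k ^ k * \prod_i F i <= (\sum_i F i) ^ k.
Proof.
case: k F => [|k] F; first by rewrite big_ord0.
have := (Num.Theory.leif_AGM (F := rat) (A := [pred i : 'I_k.+1 | true])
  (E := fun i => (F i)%:R%R) (fun i _ => Num.Theory.ler0n _ _)).1.
rewrite card_ord /= (eq_bigl xpredT) // (eq_bigl xpredT (fun i => (F i)%:R)%R) //.
rewrite -GRing.natr_prod -GRing.natr_sum GRing.expr_div_n.
rewrite Num.Theory.ler_pdivlMr; last by rewrite Num.Theory.exprn_gt0 // Num.Theory.ltr0n.
by rewrite -!GRing.natrX -GRing.natrM Num.Theory.ler_nat mulnC.
Qed.

(** * Weight functions under which given edges form a chain *)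

Section Weights.
Variables (V : finType) (K : nat).
Implicit Types (f : {ffun V -> 'I_K}) (e : {set V}).

(* Ties between weights are broken by a fixed enumeration of the vertices. *)
Definition key f (v : V) : nat := f v * #|V| + enum_rank v.

Lemma key_inj f : injective (key f).
Proof.
move=> u v; rewrite /key => h; apply: enum_rank_inj; apply: val_inj.
have := congr1 (modn^~ #|V|) h.
by rewrite /= !modnMDl !modn_small // ltn_ord.
Qed.

Lemma key_div f v : key f v %/ #|V| = f v.
Proof.
rewrite /key divnMDl; first by rewrite divn_small ?addn0 // ltn_ord.
by apply/card_gt0P; exists v.
Qed.

Lemma ltn_key f v a : (key f v < a * #|V|) = (f v < a).
Proof.
rewrite -ltn_divLR ?key_div //.
by apply/card_gt0P; exists v.
Qed.

Lemma leq_key f u v : key f u <= key f v -> f u <= f v.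
Proof. by rewrite -!key_div; apply: leq_div2r. Qed.

Definition spans f e (u v : V) : bool :=
  [&& u \in e, v \in e & [forall x in e, key f u <= key f x <= key f v]].

Lemma spansP f e u v x : spans f e u v -> x \in e -> key f u <= key f x <= key f v.
Proof. by case/and3P=> _ _ /forallP/(_ x)/implyP; apply. Qed.

Lemma spans_exists f e : 0 < #|e| -> exists u v, spans f e u v.
Proof.
case/card_gt0P=> x xe.
case: (arg_minnP (key f) xe) => u ue umin; case: (arg_maxnP (key f) xe) => v ve vmax.
exists u, v; apply/and3P; split=> //; apply/forallP => y; apply/implyP => ye.
by apply/andP; split; [apply: umin | apply: vmax].
Qed.

Definition chain_within lo D L m (A : {ffun 'I_m.+1 -> {set V}}) f : bool :=
  [exists v : {ffun 'I_m.+2 -> V},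
    [&& [forall i : 'I_m.+1, spans f (A i) (v (inord i)) (v (inord i.+1))
                             && (f (v (inord i)) + L <= f (v (inord i.+1)))],
        lo <= f (v ord0) & f (v ord_max) <= lo + D]].

(** Fix the weights of the [m] junctions of consecutive edges; the binomial counts these choices.
    Every vertex of an edge then lies in the interval between the ends of that edge, and the product
    of the interval sizes is bounded by AM-GM. A junction has only one possible weight, which saves
    a factor of at least [L.+1] in each of its two edges. *)
Lemma card_chain_within lo Y L m n (A : {ffun 'I_m.+1 -> {set V}}) :
  1 < n -> (forall i, #|A i| = n) ->
  #|[set f | chain_within lo (Y + m.+1 * L) L A f]| * L.+1 ^ (2 * m)
     * m.+1 ^ (m.+1 * n) * K ^ (m.+1 * n - m)
   <= 'C(m + Y, m) * (Y + m.+1 * L + m.+1) ^ (m.+1 * n) * K ^ #|V|.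
Proof.
move=> n1 An; set D := Y + m.+1 * L.
(* One weight function [f0] with this chain suffices to locate the junctions and to bound the
   overlaps of the edges of [A]. *)
case: (set_0Vmem [set f | chain_within lo D L A f]) => [->|[f0]].
  by rewrite cards0.
rewrite inE => /existsP[v0 /and3P[/forallP ch0 _ _]].
pose w j := v0 (inord j).
have sp (i : 'I_m.+1) : spans f0 (A i) (w i) (w i.+1) by case/andP: (ch0 i).
have wA (i : 'I_m.+1) : w i \in A i by case/and3P: (sp i).
have wSA (i : 'I_m.+1) : w i.+1 \in A i by case/and3P: (sp i).
have kS i : i < m.+1 -> key f0 (w i) < key f0 (w i.+1).
  move=> im; have := sp (Ordinal im) => /= s; have sP := spansP s.
  have /andP[_ le] := sP _ (wA (Ordinal im)).
  rewrite ltn_neqAle le andbT; apply/negP => /eqP eqk.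
  have : #|A (Ordinal im)| <= 1.
    apply/card_le1_eqP => x y /sP/andP[x1 x2] /sP/andP[y1 y2].
    by apply: (@key_inj f0); lia.
  by rewrite An; lia.
have klt i j : i < j -> j <= m.+1 -> key f0 (w i) < key f0 (w j).
  elim: j => // j IH; rewrite ltnS leq_eqVlt => /orP[/eqP ->|ij] jm; first exact: kS.
  by apply: ltn_trans (IH ij (ltnW jm)) (kS _ jm).
have kle i j : i <= j -> j <= m.+1 -> key f0 (w i) <= key f0 (w j).
  by rewrite leq_eqVlt => /orP[/eqP ->//|ij] jm; apply/ltnW/klt.
pose conn := [set u | [exists j : 'I_m, u == w j.+1]].
pose U := \bigcup_i A i.
pose B i := A i :\: conn.
(* [c i] counts the ends of edge [i] that are junctions: the outer ends of the chain are not. *)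
pose c (i : 'I_m.+1) : nat := (0 < i) + (i < m).
have sumc : \sum_i c i = 2 * m.
  rewrite big_split /= big_ord_recl [X in _ + X]big_ord_recr /= ltnn addn0 add0n.
  under eq_bigr do rewrite /bump /=.
  under [X in _ + X]eq_bigr => i _ do rewrite ltn_ord.
  by rewrite !sum1_card card_ord; lia.
have cardB i : #|B i| + c i <= n.
  rewrite -(An i) -(cardsID conn (A i)) addnC leq_add2r.
  have wi : (0 < i) -> w i \in A i :&: conn.
    move=> i0; rewrite inE wA inE /=; apply/existsP.
    have im : i.-1 < m by have := ltn_ord i; lia.
    by exists (Ordinal im); rewrite /= prednK.
  have wi1 : (i < m) -> w i.+1 \in A i :&: conn.
    by move=> im; rewrite inE wSA inE; apply/existsP; exists (Ordinal im).
  rewrite /c; case: (posnP i) => i0; case: (ltnP i m) => im //=; rewrite ?addn0 ?add0n.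
  - by apply/card_gt0P; exists (w i.+1); apply: wi1.
  2: by apply/card_gt0P; exists (w i); apply: wi.
  have ne : w i != w i.+1.
    by apply/eqP => ew; have := kS i (ltn_ord i); rewrite ew ltnn.
  rewrite addn1 (_ : 2 = #|[set w i; w i.+1]|); last by rewrite cards2 ne.
  apply: subset_leq_card; apply/subsetP => x; rewrite !in_set2.
  by case/orP=> /eqP ->; [apply: wi | apply: wi1].
have cardU : m.+1 * n - m <= #|U|.
  (* Without their first vertices, all edges after the initial one become disjoint, because keys
     increase along the chain. *)
  pose B' (i : 'I_m.+1) := if i == ord0 then A i else A i :\ w i.
  apply: leq_trans (_ : \sum_i #|B' i| <= _).
    rewrite big_ord_recl /B' eqxx An.
    rewrite (eq_bigr (fun=> n.-1)); first by rewrite sum_nat_const card_ord; nia.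
    move=> i _; rewrite (_ : (lift ord0 i == ord0) = false) //; have := cardsD1 (w (lift ord0 i)) (A (lift ord0 i)).
    by rewrite An wA add1n => ->.
  apply: sum_mem_card => [i|u i j].
    apply: subset_trans (bigcup_sup i _) => //.
    by rewrite /B'; case: ifP => // _; apply: subD1set.
  have B'A k : u \in B' k -> u \in A k by rewrite /B'; case: ifP => // _; rewrite inE => /andP[].
  have B'lt k : u \in B' k -> 0 < k -> key f0 (w k) < key f0 u.
    move=> uk k0; have /andP[le _] := spansP (sp k) (B'A _ uk).
    rewrite ltn_neqAle le andbT; apply/eqP => ek; move: uk.
    rewrite /B' -val_eqE /= (_ : (val k == 0) = false); last by apply/negbTE; rewrite -lt0n.
    by rewrite (key_inj ek) !inE eqxx.
  move=> ui uj; apply: val_inj => /=.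
  wlog ij : i j ui uj / i < j.
    by move=> W; case: (ltngtP i j) => // h; [apply: W | apply/esym/W].
  have /andP[_ h1] := spansP (sp i) (B'A _ ui).
  have h2 := B'lt _ uj (leq_ltn_trans (leq0n i) ij).
  have := kle i.+1 j ij (ltnW (ltn_ord j)); lia.
(* [x z j] is a guess for the weight of junction [j]. Subtracting [lo + j * L] turns gaps of at
   least [L] into a weakly increasing tuple with entries up to [Y]. The outer ends are relaxed to
   the ends of the window. *)
pose x (z : m.-tuple 'I_Y.+1) j := if j == 0 then lo else
  if j == m.+1 then lo + D else lo + j * L + nth 0 (map val z) j.-1.
pose sorted_z (z : m.-tuple 'I_Y.+1) := sorted leq (map val z).
have xS z i : sorted_z z -> i < m.+1 -> x z i + L <= x z i.+1.
  move=> sz im; rewrite /x /= eqSS (_ : (i == m.+1) = false); last by lia.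
  have zY j : nth 0 (map val z) j <= Y.
    case: (ltnP j m) => jm; last by rewrite nth_default // size_map size_tuple.
    by rewrite (nth_map ord0) ?size_tuple // -ltnS ltn_ord.
  case: eqVneq => [->|i0]; case: eqVneq => [im'|nm].
  - by rewrite /D; nia.
  - lia.
  - by have := zY i.-1; rewrite /D im' /=; nia.
  - have : nth 0 (map val z) i.-1 <= nth 0 (map val z) i.
      by apply: (sorted_leq_nth leq_trans leqnn 0 sz); rewrite ?inE ?size_map ?size_tuple; lia.
    by rewrite mulSn /=; lia.
pose S z (u : V) := [set y : 'I_K | [forall i : 'I_m.+1,
   (u \in A i) ==> (x z i <= y <= x z i.+1)]].
have cover : [set f | chain_within lo D L A f] \subset
    \bigcup_(z | sorted_z z) [set f : {ffun V -> 'I_K} | [forall u, f u \in S z u]].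
  apply/subsetP => f; rewrite inE => /existsP[v /and3P[/forallP ch lov hiv]].
  pose y j := f (v (inord j)) : nat.
  have yS i : i < m.+1 -> y i + L <= y i.+1.
    by move=> im; case/andP: (ch (Ordinal im)).
  have y0 : lo <= y 0.
    by rewrite /y (_ : inord 0 = ord0) //; apply: val_inj; rewrite /= inordK.
  have ym : y m.+1 <= lo + D.
    by rewrite /y (_ : inord m.+1 = ord_max) //; apply: val_inj; rewrite /= inordK.
  have ylo j : j <= m.+1 -> lo + j * L <= y j.
    elim: j => [|j IH] jm; first by rewrite mul0n addn0.
    by have := yS j jm; have := IH (ltnW jm); rewrite mulSn; lia.
  have yhi j : j <= m.+1 -> y j <= lo + Y + j * L.
    move=> jm; rewrite -(subKn jm); move: (m.+1 - j) (leq_subr j m.+1) => d.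
    elim: d => [|d IH] dm; first by rewrite subn0 -addnA.
    have := yS (m.+1 - d.+1); rewrite -subSn // subSS => /(_ _).
    have := IH (ltnW dm); have e1 : m.+1 - d = (m.+1 - d.+1).+1 by lia.
    rewrite {2}e1 mulSn; lia.
  have zlt (i : 'I_m) : y i.+1 - lo - i.+1 * L < Y.+1.
    by have := yhi i.+1; have := ltn_ord i; lia.
  pose z := [tuple Ordinal (zlt i) | i < m].
  have zE i : i < m -> nth 0 (map val z) i = y i.+1 - lo - i.+1 * L.
    move=> im; rewrite (nth_map ord0) ?size_tuple //.
    by rewrite -[i]/(val (Ordinal im)) -tnth_nth tnth_mktuple.
  apply/bigcupP; exists z.
    apply/(sortedP 0) => i; rewrite size_map size_tuple => im.
    rewrite !zE //; last by lia.
    have := yS i.+1; have := ylo i.+1; rewrite (mulSn i.+1); lia.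
  have xz j : 0 < j <= m -> x z j = y j.
    move=> /andP[j0 jm]; rewrite /x (_ : (j == 0) = false); last by lia.
    rewrite (_ : (j == m.+1) = false); last by lia.
    by rewrite zE ?prednK //; have := ylo j; lia.
  rewrite inE; apply/forallP => u; rewrite inE; apply/forallP => i.
  apply/implyP => uA; have /andP[s _] := ch i.
  have /andP[/leq_key k1 /leq_key k2] := spansP s uA.
  have im := ltn_ord i.
  apply/andP; split.
    case: (posnP i) => [i0|i0]; last by rewrite xz // i0.
    by rewrite /x i0 /=; apply: leq_trans y0 _; rewrite /y -i0.
  case: (ltnP i m) => im'; first by rewrite xz.
  have -> : x z i.+1 = lo + D by rewrite /x /= eqSS (_ : (val i == m)) //; apply/eqP => /=; lia.
  have ei : val i = m by move=> /=; lia.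
  by apply: leq_trans k2 _; have -> : f (v (inord i.+1)) = y m.+1 :> nat by rewrite -/(y i.+1); congr (y _.+1).
(* The intervals of two consecutive edges meet in a single point, so a junction has at most one
   value; another vertex of [U] is confined to the interval of an edge containing it, and the rest
   are free. *)
have cardS z u : sorted_z z -> #|S z u| <= (if u \in U then 1 else K) *
    \prod_i (if u \in B i then (x z i.+1 - x z i).+1 else 1).
  move=> sz; have pos (P : pred 'I_m.+1) : 0 < \prod_(i | P i)
      (if u \in B i then (x z i.+1 - x z i).+1 else 1).
    by rewrite prodn_gt0 // => i; case: ifP.
  case: ifP => uU; last first.
    apply: leq_trans (max_card _) _; rewrite card_ord.
    by rewrite leq_pmulr.
  rewrite mul1n; case uc : (u \in conn).
    apply: leq_trans (pos xpredT); apply/card_le1_eqP => a b.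
    move: uc; rewrite inE => /existsP[j /eqP uj].
    have jm : j < m.+1 by apply: leq_trans (ltn_ord j) _.
    have jm1 : j.+1 < m.+1 by rewrite ltnS.
    have uA1 : u \in A (Ordinal jm) by rewrite uj; apply: (wSA (Ordinal jm)).
    have uA2 : u \in A (Ordinal jm1) by rewrite uj; apply: (wA (Ordinal jm1)).
    rewrite !inE => /forallP ha /forallP hb; apply: val_inj => /=.
    have := implyP (ha (Ordinal jm)) uA1; have := implyP (ha (Ordinal jm1)) uA2.
    have := implyP (hb (Ordinal jm)) uA1; have := implyP (hb (Ordinal jm1)) uA2.
    move=> /=; lia.
  have /bigcupP[i _ uA] := uU.
  rewrite (bigD1 i) //= {1}/B inE uc uA /=.
  apply: leq_trans (_ : (x z i.+1 - x z i).+1 <= _); last by rewrite leq_pmulr.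
  apply: leq_trans (card_ord_interval K (x z i) (x z i.+1)).
  apply: subset_leq_card; apply/subsetP => a; rewrite !inE.
  by move=> /forallP/(_ i)/implyP; apply.
have card1 z : sorted_z z ->
  #|[set f : {ffun V -> 'I_K} | [forall u, f u \in S z u]]| * L.+1 ^ (2 * m)
     * m.+1 ^ (m.+1 * n) * K ^ (m.+1 * n - m) <= (D + m.+1) ^ (m.+1 * n) * K ^ #|V|.
  move=> sz; rewrite card_family_prod.
  have -> : K ^ #|V| = K ^ (#|V| - #|U|) * K ^ #|U|.
    by rewrite -expnD subnK ?max_card.
  pose P := \prod_(i < m.+1) (x z i.+1 - x z i).+1.
  have h1 : \prod_u #|S z u| <= K ^ (#|V| - #|U|) *
      \prod_(i < m.+1) (x z i.+1 - x z i).+1 ^ #|B i|.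
    apply: leq_trans (leq_prod (fun u _ => cardS z u sz)) _.
    rewrite big_split /= leq_mul //.
      rewrite (bigID (mem U)) /= big1 ?mul1n; last by move=> u ->.
      rewrite (eq_bigr (fun=> K)); last by move=> u /negbTE ->.
      rewrite prod_nat_const leq_eqVlt; apply/orP; left; apply/eqP; congr (_ ^ _).
      by rewrite -(cardC (mem U)) addKn; apply: eq_card => u; rewrite !inE.
    rewrite exchange_big /=; apply: leq_prod => i _.
    by rewrite -big_mkcond /= prod_nat_const.
  have h2 : \prod_(i < m.+1) (x z i.+1 - x z i).+1 ^ #|B i| * L.+1 ^ (2 * m) <= P ^ n.
    rewrite -sumc expn_sum -big_split /P /=.
    rewrite (big_morph (expn^~ n) (fun a b => expnMn a b n) (exp1n n)).
    apply: leq_prod => i _.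
    have Lx : L.+1 <= (x z i.+1 - x z i).+1 by have := xS z i sz (ltn_ord i); lia.
    apply: leq_trans (_ : (x z i.+1 - x z i).+1 ^ (#|B i| + c i) <= _).
      by rewrite expnD leq_mul2l leq_expl ?orbT.
    by rewrite leq_pexp2l.
  (* The sum in AM-GM telescopes to [D], plus one for each of the [m.+1] intervals. *)
  have h3 : m.+1 ^ m.+1 * P <= (D + m.+1) ^ m.+1.
    apply: leq_trans (agm_nat _) _; rewrite leq_exp2r // leq_eqVlt; apply/orP; left.
    apply/eqP; pose s j := \sum_(i < j) (x z i.+1 - x z i).+1.
    have sE j : j <= m.+1 -> s j + x z 0 = x z j + j.
      elim: j => [|j IH] jm; first by rewrite /s big_ord0 addn0.
      rewrite /s big_ord_recr /= -/(s j); have := IH (ltnW jm).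
      by have := xS z j sz jm; lia.
    have xm : x z m.+1 = lo + D by rewrite /x eqxx.
    have := sE m.+1 (leqnn _); rewrite xm addnC -addnA => /eqP.
    by rewrite (_ : x z 0 = lo) // eqn_add2l => /eqP.
  have h4 : m.+1 ^ (m.+1 * n) * P ^ n <= (D + m.+1) ^ (m.+1 * n).
    by rewrite !expnM -expnMn leq_expl.
  have h5 : K ^ (m.+1 * n - m) <= K ^ #|U|.
    case: (posnP K) => K0; last by rewrite leq_pexp2l.
    by have := ltn_ord (f0 (w 0)); lia.
  set a := \prod_u _ in h1 *; set b := K ^ (_ - _) in h1 *.
  apply: leq_trans (_ : b * P ^ n * m.+1 ^ (m.+1 * n) * K ^ #|U| <= _).
    rewrite leq_mul // leq_mul2r; apply/orP; right.
    apply: leq_trans (leq_mul h1 (leqnn _)) _.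
    by rewrite -mulnA leq_mul2l h2 orbT.
  have := leq_mul (leqnn (b * K ^ #|U|)) h4; clear h1 h2 h3 h4 h5.
  move: (m.+1 ^ (m.+1 * n)) (P ^ n) ((D + m.+1) ^ (m.+1 * n)) (K ^ #|U|) b.
  by move=> m0 p0 d0 k0 b0; lia.
apply: leq_trans (_ : (\sum_(z | sorted_z z)
    #|[set f : {ffun V -> 'I_K} | [forall u, f u \in S z u]]|) * L.+1 ^ (2 * m)
     * m.+1 ^ (m.+1 * n) * K ^ (m.+1 * n - m) <= _).
  rewrite !leq_mul2r; apply/orP; right; apply/orP; right; apply/orP; right.
  apply: leq_trans (subset_leq_card cover) _.
  elim/big_rec2: _ => [|z p q _ IH]; first by rewrite cards0.
  by apply: leq_trans (leq_card_setU _ _) _; rewrite leq_add2l.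
rewrite !big_distrl /=.
apply: leq_trans (_ : \sum_(z | sorted_z z) (D + m.+1) ^ (m.+1 * n) * K ^ #|V| <= _).
  by apply: leq_sum => z sz; apply: card1.
rewrite sum_nat_const -mulnA leq_mul2r; apply/orP; right.
by rewrite -card_sorted_tuples cardsE.
Qed.

End Weights.

Lemma card_bigcup_le (I T : finType) (P : pred I) (F : I -> {set T}) :
  #|\bigcup_(i | P i) F i| <= \sum_(i | P i) #|F i|.
Proof.
elim/big_rec2: _ => [|i p q _ IH]; first by rewrite cards0.
by apply: leq_trans (leq_card_setU _ _) _; rewrite leq_add2l.
Qed.

(** This serves to bound the vertices that start or end walks by the number of chains, since a chain
    determines its first and its last vertex. *)
Lemma card_functional_rel (S T : finType) (X : {set S}) (Y : {set T}) (R : S -> T -> bool) :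
  (forall x, x \in X -> exists2 y, y \in Y & R x y) ->
  (forall x x' y, R x y -> R x' y -> x = x') -> #|X| <= #|Y|.
Proof.
move=> XY Rf; case: (set_0Vmem X) => [->|[x0 x0X]]; first by rewrite cards0.
have [y0 _ _] := XY _ x0X.
pose F x := odflt y0 [pick y in Y | R x y].
have FP x : x \in X -> F x \in Y /\ R x (F x).
  rewrite /F => /XY[y yY Rxy]; case: pickP => [z /andP[]//|/(_ y)].
  by rewrite /= yY Rxy.
rewrite -(card_in_imset (f := F)); last first.
  by move=> x x' /FP[_ h] /FP[_ h'] e; apply: Rf h _; rewrite e.
by apply: subset_leq_card; apply/subsetP => y /imsetP[x /FP[h _] ->].
Qed.

(** * Short edges and deviations of the empirical distribution *)

Section Events.
Variables (V : finType) (K : nat).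
Implicit Types (f : {ffun V -> 'I_K}) (e : {set V}).

Lemma card_weights : #|{ffun V -> 'I_K}| = K ^ #|V|.
Proof. by rewrite card_ffun card_ord. Qed.

Definition short_edge L e f : bool :=
  [exists u in e, [forall x in e, f u <= f x < f u + L]].

(** Choose the vertex of least weight and its weight; each of the other [n] vertices of [e] is left
    with at most [L] values. *)
Lemma card_short_edge L e n : #|e| = n.+1 ->
  #|[set f | short_edge L e f]| * K ^ n <= n.+1 * L ^ n * K ^ #|V|.
Proof.
move=> en.
pose S u (y : 'I_K) x := if x == u then [set y] else
  if x \in e then [set z : 'I_K | y <= z < y + L] else setT.
have cover : [set f | short_edge L e f] \subset
   \bigcup_(u in e) \bigcup_(y : 'I_K) [set f : {ffun V -> 'I_K} | [forall x, f x \in S u y x]].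
  apply/subsetP => f; rewrite inE => /existsP[u /andP[ue /forallP sh]].
  apply/bigcupP; exists u => //; apply/bigcupP; exists (f u) => //.
  rewrite inE; apply/forallP => x; rewrite /S; case: eqVneq => [->|_]; first by rewrite inE.
  case: ifP => xe; last by rewrite inE.
  by rewrite inE; apply: (implyP (sh x)).
have card1 u y : u \in e ->
    #|[set f : {ffun V -> 'I_K} | [forall x, f x \in S u y x]]| <= L ^ n * K ^ (#|V| - n.+1).
  move=> ue; rewrite card_family_prod (bigID (mem e)) /= leq_mul //.
    rewrite (bigD1 u) //= {1}/S eqxx cards1 mul1n.
    apply: leq_trans (_ : \prod_(x in e | x != u) L <= _).
      apply: leq_prod => x /andP[xe xu]; rewrite /S (negbTE xu) xe.
      case: (posnP L) => L0.
        by rewrite (_ : [set z : 'I_K | _] = set0) ?cards0 //; apply/setP => z; rewrite !inE; lia.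
      apply: (@leq_trans (y + L.-1 - y).+1); last by lia.
      apply: leq_trans (card_ord_interval K _ _); apply: subset_leq_card.
      by apply/subsetP => z; rewrite !inE; lia.
    rewrite prod_nat_const leq_eqVlt; apply/orP; left; apply/eqP; congr (_ ^ _).
    have := cardsD1 u e; rewrite en ue add1n => -[->].
    by apply: eq_card => x; rewrite !inE andbC.
  apply: leq_trans (_ : \prod_(x | x \notin e) K <= _).
    by apply: leq_prod => x xe; apply: leq_trans (max_card _) _; rewrite card_ord.
  rewrite prod_nat_const leq_eqVlt; apply/orP; left; apply/eqP; congr (_ ^ _).
  by rewrite -en -(cardC (mem e)) addKn; apply: eq_card => u'; rewrite !inE.
have eV : n.+1 <= #|V| by rewrite -en max_card.
apply: leq_trans (_ : n.+1 * K * (L ^ n * K ^ (#|V| - n.+1)) * K ^ n <= _).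
  rewrite leq_mul2r; apply/orP; right; apply: leq_trans (subset_leq_card cover) _.
  apply: leq_trans (card_bigcup_le _ _) _.
  apply: leq_trans (_ : \sum_(u in e) K * (L ^ n * K ^ (#|V| - n.+1)) <= _).
    apply: leq_sum => u ue; apply: leq_trans (card_bigcup_le _ _) _.
    rewrite -[X in X * _](card_ord K) -sum_nat_const.
    by apply: leq_sum => y _; apply: card1.
  by rewrite sum_nat_const en mulnA.
have -> : K ^ #|V| = K ^ (#|V| - n.+1) * (K * K ^ n) by rewrite -expnS -expnD subnK.
by rewrite leq_eqVlt; apply/orP; left; apply/eqP; lia.
Qed.

Definition cdf a f : nat := #|[set v | f v < a]|.

Section Chebyshev.
Import Order.TTheory GRing.Theory Num.Theory.
Local Open Scope ring_scope.

(** Weights of distinct vertices are independent, so centered terms are uncorrelated. *)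
Lemma sum_ffun_prod2 (c : 'I_K -> int) (u v : V) : u != v -> \sum_x c x = 0 ->
  \sum_(f : {ffun V -> 'I_K}) c (f u) * c (f v) = 0.
Proof.
move=> uv c0.
pose G w x := (if w == u then c x else 1) * (if w == v then c x else 1).
have GE (f : {ffun V -> 'I_K}) : c (f u) * c (f v) = \prod_w G w (f w).
  rewrite big_split /=; congr (_ * _).
    by rewrite -big_mkcond big_pred1_eq.
  by rewrite -big_mkcond big_pred1_eq.
under eq_bigr do rewrite GE.
rewrite -(bigA_distr_bigA G) (bigD1 u) //= /G eqxx (negbTE uv).
under eq_bigr do rewrite mulr1.
by rewrite c0 mul0r.
Qed.

(** Chebyshev's inequality: [K * cdf a f - a * #|V|] is a sum of uncorrelated centered terms of
    absolute value at most [K]. Scaling by [K] keeps everything integral. *)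
Lemma card_cdf_deviates a D : (a <= K)%N ->
  (#|[set f | (a * #|V| + D <= K * cdf a f) || (K * cdf a f + D <= a * #|V|)]| * D ^ 2
    <= #|V| * K ^ 2 * K ^ #|V|)%N.
Proof.
move=> aK; pose c (x : 'I_K) : int := (K * (x < a))%N%:Z - a%:Z.
have c0 : \sum_x c x = 0.
  rewrite sumrB sumr_const card_ord -rmorph_sum /= -big_distrr /=.
  rewrite -big_mkcond /= -(big_ord_widen K (fun=> 1%N) aK) sum1_card card_ord.
  by rewrite -mulr_natr natz -PoszM mulnC subrr.
have csq x : c x ^+ 2 <= (K ^ 2)%N%:Z.
  rewrite /c; case: (x < a)%N; rewrite ?muln1 ?muln0; nia.
pose X (f : {ffun V -> 'I_K}) := \sum_v c (f v).
have XE f : X f = (K * cdf a f)%N%:Z - (a * #|V|)%N%:Z.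
  rewrite /X sumrB sumr_const -rmorph_sum /= -big_distrr /= -big_mkcond /= sum1_card.
  by rewrite -mulr_natr natz -PoszM /cdf cardsE.
have EX2 : \sum_f X f ^+ 2 <= (#|V| * K ^ 2 * K ^ #|V|)%N%:Z.
  have -> : \sum_f X f ^+ 2 = \sum_u \sum_(f : {ffun V -> 'I_K}) c (f u) ^+ 2.
    under eq_bigr do rewrite expr2 /X big_distrlr /=.
    rewrite exchange_big /=; apply: eq_bigr => u _.
    rewrite exchange_big /= (bigD1 u) //= [X in _ + X]big1 ?addr0 //.
    by move=> v vu; apply: sum_ffun_prod2; rewrite // eq_sym.
  apply: le_trans (_ : \sum_(u : V) \sum_(f : {ffun V -> 'I_K}) (K ^ 2)%N%:Z <= _).
    by apply: ler_sum => u _; apply: ler_sum.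
  rewrite !sumr_const card_weights -mulrnA -mulr_natr natz -PoszM lez_nat.
  by rewrite leq_eqVlt; apply/orP; left; apply/eqP; rewrite -[#|xpredT|]/#|V|; lia.
rewrite -lez_nat; apply: le_trans EX2.
rewrite -sum1_card big_distrl /= -natz natr_sum.
under eq_bigr do rewrite mul1n natz.
rewrite big_mkcond /=; apply: ler_sum => f _; rewrite inE XE.
case: ifP => [dev|_]; last exact: sqr_ge0.
move: (K * _)%N (a * _)%N dev => y z dev.
rewrite expnS expn1 PoszM expr2.
set t := y%:Z - z%:Z; have ht : (D%:Z <= t) \/ (D%:Z <= - t).
  by case/orP: dev => h; [left | right]; rewrite /t; lia.
clearbody t; have D0 : 0 <= D%:Z by [].
by case: ht => ht; [|rewrite -[X in _ <= X](mulrNN t t)]; apply: ler_pM.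
Qed.
End Chebyshev.
End Events.

(** * Weights that give an equitable coloring *)

Section EdgeWalks.
Variables (V : finType) (K : nat) (E : {set {set V}}).
Implicit Type f : {ffun V -> 'I_K}.

Definition edge_step f (u v : V) : bool := [exists e in E, spans f e u v].

Lemma edge_step_lt n f u v :
  1 < n -> uniform n E -> edge_step f u v -> key f u < key f v.
Proof.
move=> n_gt1 E_unif.
case/existsP=> e /andP[eE s]; have sP := spansP s.
have /andP[ue ve] : (u \in e) && (v \in e) by case/and3P: s => -> ->.
have /andP[le _] := sP _ ve; rewrite ltn_neqAle le andbT; apply/eqP => ek.
have : #|e| <= 1.
  apply/card_le1_eqP => x y /sP/andP[x1 x2] /sP/andP[y1 y2].
  by apply: (@key_inj _ _ f); lia.
by rewrite (E_unif _ eE); lia.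
Qed.

Lemma spans_long L f e u v :
  (forall e, e \in E -> ~~ short_edge L e f) -> e \in E -> spans f e u v ->
  f u + L <= f v.
Proof.
move=> ns eE s; rewrite leqNgt; apply/negP => lt.
move/negP: (ns e eE); apply; apply/existsP; exists u.
have /and3P[-> _ _] /= := s; apply/forallP => x; apply/implyP => xe.
have /andP[/leq_key k1 /leq_key k2] := spansP s xe.
by rewrite k1 (leq_ltn_trans k2 lt).
Qed.

Lemma walk_edges f k u v : walk (edge_step f) k u v ->
  exists A w, [/\ w 0 = u, w k = v &
    forall i, i < k -> A i \in E /\ spans f (A i) (w i) (w i.+1)].
Proof.
elim: k v => [|k IH] v /=.
  by move/eqP=> <-; exists (fun=> set0), (fun=> u).
case/existsP=> x /andP[/IH[A [w [w0 wk Aw]]] /existsP[e /andP[eE s]]].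
exists (fun i => if i == k then e else A i), (fun i => if i == k.+1 then v else w i).
split=> //=; first by rewrite eqxx.
move=> i; rewrite ltnS leq_eqVlt => /orP[/eqP ->|ik].
  by rewrite !eqxx ltn_eqF ?wk.
by rewrite eqSS (ltn_eqF ik) (ltn_eqF (leqW ik)); apply: Aw.
Qed.

Lemma walk_long L f k u v :
  (forall e, e \in E -> ~~ short_edge L e f) -> walk (edge_step f) k u v ->
  f u + k * L <= f v.
Proof.
move=> ns /walk_edges[A [w [<- <- Aw]]].
elim: k Aw => [|k IH] Aw; first by rewrite mul0n addn0.
have [AE s] := Aw k (ltnSn _); have := spans_long ns AE s.
by have := IH (fun i ik => Aw i (ltnW ik)); rewrite mulSn; lia.
Qed.

Lemma walk_chain L f m u v lo D :
  (forall e, e \in E -> ~~ short_edge L e f) -> walk (edge_step f) m.+1 u v ->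
  lo <= f u -> f v <= lo + D ->
  exists2 A : {ffun 'I_m.+1 -> {set V}},
    (A \in ffun_on (mem E)) && chain_within lo D L A f
    & (exists w, spans f (A ord0) u w) /\ (exists w, spans f (A ord_max) w v).
Proof.
move=> ns /walk_edges[A [w [w0 wk Aw]]] lou hiv.
exists [ffun i : 'I_m.+1 => A i].
  apply/andP; split; first by apply/ffun_onP => i; rewrite ffunE; have [] := Aw i (ltn_ord i).
  apply/existsP; exists [ffun i : 'I_m.+2 => w i].
  apply/and3P; split; last 2 first.
  - by rewrite ffunE w0.
  - by rewrite ffunE wk.
  apply/forallP => i; have im := ltn_ord i; have [AE s] := Aw i im.
  rewrite !ffunE !inordK; [|lia|lia].
  by rewrite s /=; apply: spans_long ns AE s.
split; rewrite ffunE /=.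
  by exists (w 1); rewrite -w0; have [] := Aw 0 (ltn0Sn _).
by exists (w m); rewrite -wk; have [] := Aw m (ltnSn _).
Qed.

Lemma spans_first_uniq f e u u' w w' : spans f e u w -> spans f e u' w' -> u = u'.
Proof.
move=> s s'; have /and3P[ue _ _] := s; have /and3P[u'e _ _] := s'.
have := spansP s u'e; have := spansP s' ue => h1 h2.
by apply: (@key_inj _ _ f); lia.
Qed.

Lemma spans_last_uniq f e u u' w w' : spans f e w u -> spans f e w' u' -> u = u'.
Proof.
move=> s s'; have /and3P[_ ue _] := s; have /and3P[_ u'e _] := s'.
have := spansP s u'e; have := spansP s' ue => h1 h2.
by apply: (@key_inj _ _ f); lia.
Qed.

Definition chains lo D L m f : {set {ffun 'I_m.+1 -> {set V}}} :=
  [set A | (A \in ffun_on (mem E)) && chain_within lo D L A f].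

End EdgeWalks.

Section GoodWeights.
(** In units of weight, a block has width about [kap], an edge may be shorter than that by at most
    [q], and the cut windows have half-width [h]. [T] is the allowance for vertices that change
    color at a cut. *)
Variables (V : finType) (E : {set {set V}}) (n r M kap q h T : nat).
Hypothesis n_gt1 : 1 < n.
Hypothesis E_unif : uniform n E.
Hypothesis r_gt0 : 0 < r.
Hypothesis card_V : #|V| = r * M.
Hypothesis small_gaps : r.+1 * q + 2 * h < kap.

Let L := kap - q.
(** This equals [k * kap + 2 * b], the width of [k] blocks widened by [b] on both sides; it is
    written as slack plus [k * L] to fit [card_chain_within]. *)
Let span k b := k * q + 2 * b + k * L.

Variables (K : nat) (f : {ffun V -> 'I_K}).
Hypothesis K_def : K = r * kap.
Hypothesis no_short : forall e, e \in E -> ~~ short_edge L e f.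
Hypothesis no_r_chain : chains E 0 (span r.-1.+1 0) L r.-1 f = set0.
Hypothesis few_chains :
  \sum_(i < r) \sum_(m < r.-1) #|chains E (i * kap - h) (span m.+1 h) L m f| <= T.
Hypothesis cdf_lo : forall j, 0 < j < r -> cdf (j * kap - h) f + T <= j * M.
Hypothesis cdf_hi : forall j, 0 < j < r -> j * M + T <= cdf (j * kap + h) f.

(** Multiplied by [#|V|], the weight windows become key windows for [balanced_walk_coloring]. An arc
    joins the first and last vertex of each edge, so no edge is monochromatic. *)
Lemma good_weights_coloring : exists c : V -> 'I_r, equitable_coloring E c.
Proof.
have qk : q <= kap by nia.
have spanE k b : span k b = k * kap + 2 * b.
  by rewrite /span /L; have := leq_mul (leqnn k) qk; rewrite mulnBr; lia.
have [] := @balanced_walk_coloring V (key f) (edge_step E f) r M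
  (fun j => (j * kap - h) * #|V|) (fun j => (j * kap + h) * #|V|).
- exact: key_inj.
- by move=> u v; apply: edge_step_lt n_gt1 E_unif.
- by [].
- by [].
- by rewrite mul0n sub0n.
- by move=> v; rewrite ltn_key; have := ltn_ord (f v); lia.
- by move=> j; rewrite leq_mul2r; lia.
- by move=> j; rewrite leq_mul2r mulSn; lia.
- move=> v; apply/negP => /existsP[w wk0].
  have wk : walk (edge_step E f) r.-1.+1 v w by rewrite prednK.
  have [|A AP _] := walk_chain (lo := 0) (D := span r.-1.+1 0) no_short wk (leq0n _).
    by rewrite spanE prednK //; have := ltn_ord (f w); lia.
  by have := in_set0 A; rewrite -no_r_chain inE AP.
(* The walk covers at least [k.+1 * (kap - q)], which exceeds the available [k * kap + 2 * h] by
   [small_gaps]. *)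
- move=> i k u v k0 ikr wk lou hiv.
  rewrite leqNgt ltn_key -leqNgt in lou; rewrite ltn_key in hiv.
  have := walk_long no_short wk; rewrite /L.
  have : k.+1 * q + 2 * h < kap by nia.
  have : k.+1 * q <= k.+1 * kap by rewrite leq_mul2l qk orbT.
  rewrite mulnBr mulnDl in hiv *; rewrite (mulSn k kap); lia.
(* A vertex that drops is the first vertex of a chain of [r - j] edges, counted in [few_chains] at
   [i = j]. *)
- move=> j jr; apply: leq_trans (cdf_lo jr); apply: leq_add.
    by rewrite /cdf; apply: subset_leq_card; apply/subsetP => v; rewrite !inE ltn_key.
  apply: leq_trans few_chains.
  have jr' : j < r by lia.
  have mr : (r - j).-1 < r.-1 by lia.
  rewrite (bigD1 (Ordinal jr')) //= (bigD1 (Ordinal mr)) //= -!addnA.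
  apply: leq_trans (leq_addr _ _).
  apply: (card_functional_rel (R := fun v (A : {ffun 'I_(r - j).-1.+1 -> {set V}}) =>
    [exists w, spans f (A ord0) v w])).
    move=> v; rewrite inE leqNgt ltn_key -leqNgt => /andP[lov /existsP[w wk0]].
    have wk : walk (edge_step E f) (r - j).-1.+1 v w by rewrite prednK ?subn_gt0.
    have [|A AP [[x Ax] _]] := walk_chain (D := span (r - j).-1.+1 h) no_short wk lov.
      rewrite spanE prednK ?subn_gt0 // mulnBl.
      have := ltn_ord (f w); have : j * kap <= r * kap by rewrite leq_mul2r ltnW ?orbT.
      by lia.
    by exists A; [rewrite inE | apply/existsP; exists x].
  by move=> v v' A /existsP[w s] /existsP[w' s']; apply: spans_first_uniq s s'.
- move=> j jr; rewrite (_ : [set v | key f v < _] = [set v | f v < j * kap + h]); last first.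
    by apply/setP => v; rewrite !inE ltn_key.
  apply: leq_trans (cdf_hi jr); rewrite leq_add2l; apply: leq_trans few_chains.
  (* The vertices that may rise are sorted by the number [m.+1] of arcs of a walk ending there; they
     are counted in [few_chains] at [i = j - m.+1]. *)
  pose X (m : 'I_r.-1) := [set v | (f v < j * kap + h) && [exists u,
    [&& m < j, walk (edge_step E f) m.+1 u v & (j - m.+1) * kap - h <= f u]]].
  apply: leq_trans (_ : #|\bigcup_m X m| <= _).
    apply: subset_leq_card; apply/subsetP => v; rewrite inE ltn_key => /andP[hiv].
    case/existsP=> k /existsP[u /and3P[k0 wk lou]].
    have kr : k.-1 < r.-1 by have := ltn_ord k; lia.
    have ek : (Ordinal kr).+1 = k by rewrite /= prednK.
    apply/bigcupP; exists (Ordinal kr) => //; rewrite inE hiv; apply/existsP; exists u.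
    rewrite ek wk; apply/and3P; split=> //; first by rewrite -ltnS ltn_ord.
    by move: lou; rewrite leqNgt ltn_key -leqNgt.
  apply: leq_trans (card_bigcup_le _ _) _; rewrite exchange_big /=.
  apply: leq_sum => m _; case: (ltnP m j) => mj; last first.
    rewrite (_ : X m = set0) ?cards0 //; apply/setP => v; rewrite !inE.
    by apply/negbTE/negP => /andP[_ /existsP[u]]; rewrite ltnNge mj.
  have ir : j - m.+1 < r by lia.
  rewrite (bigD1 (Ordinal ir)) //=; apply: leq_trans (leq_addr _ _).
  apply: (card_functional_rel (R := fun v (A : {ffun 'I_m.+1 -> {set V}}) =>
    [exists w, spans f (A ord_max) w v])).
    move=> v; rewrite inE => /andP[hiv /existsP[u /and3P[_ wk lou]]].
    have [|A AP [_ [x Ax]]] := walk_chain (D := span m.+1 h) no_short wk lou.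
      rewrite spanE mulnBl; have : m.+1 * kap <= j * kap by rewrite leq_mul2r mj orbT.
      by lia.
    by exists A; [rewrite inE | apply/existsP; exists x].
  by move=> v v' A /existsP[w s] /existsP[w' s']; apply: spans_last_uniq s s'.
move=> c [cM cstep]; exists c; split; last first.
  by move=> i j; rewrite /color_class !cM; lia.
move=> e eE [i ei].
have e0 : 0 < #|e| by rewrite (E_unif eE); lia.
have [u [v s]] := spans_exists f e0.
have /and3P[ue ve _] := s.
have : edge_step E f u v by apply/existsP; exists e; rewrite eE.
by move/cstep; rewrite (ei u) // (ei v) // eqxx.
Qed.

End GoodWeights.

(** * Random balanced colorings *)

Lemma perm_imset_eq (V : finType) (A B : {set V}) : #|A| = #|B| ->
  exists s : {perm V}, s @: A = B.
Proof.
move=> AB; pose l (X : {set V}) := enum X ++ enum (~: X).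
have lu X : uniq (l X).
  rewrite cat_uniq !enum_uniq /= andbT; apply/hasPn => x; rewrite !mem_enum inE.
  by case: (x \in X).
have lm X x : x \in l X by rewrite mem_cat !mem_enum inE; case: (x \in X).
have ls X : size (l X) = #|V| by rewrite size_cat -!cardE cardsC.
pose t x := nth x (l B) (index x (l A)).
have lt x : index x (l A) < size (l B) by rewrite ls -(ls A) index_mem.
have t_inj : injective t.
  move=> x y /eqP; rewrite /t (set_nth_default y x) // nth_uniq // => /eqP.
  by apply: index_inj.
exists (perm t_inj); apply/eqP; rewrite eqEcard card_imset ?AB ?leqnn ?andbT; last exact: perm_inj.
apply/subsetP => y /imsetP[x xA ->]; rewrite permE /t /l index_cat mem_enum xA nth_cat.
have ix : index x (enum A) < size (enum B) by rewrite -cardE -AB cardE index_mem mem_enum.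
by rewrite ix -mem_enum mem_nth.
Qed.

(** Permutations act transitively on sets of a given size, so each set of the size of [e] is mapped
    into [S] equally often. The pairs of a permutation and such a set are counted in two ways. *)
Lemma card_perm_imset_sub (V : finType) (e S : {set V}) :
  #|[set s : {perm V} | s @: e \subset S]| * 'C(#|V|, #|e|) = #|{perm V}| * 'C(#|S|, #|e|).
Proof.
pose N (e' : {set V}) := #|[set s : {perm V} | s @: e' \subset S]|.
have Neq (e' : {set V}) : #|e'| = #|e| -> N e' = N e.
  move=> /perm_imset_eq[t te]; rewrite -te /N.
  rewrite -[RHS](card_imset _ (mulgI t)); apply: eq_card => s; rewrite inE.
  apply/idP/imsetP => [se|[s' + ->]].
    exists (t^-1 * s)%g; last by rewrite mulKVg.
    rewrite inE -imset_comp; apply: subset_trans se.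
    by apply/subsetP => y /imsetP[x xe ->]; apply/imsetP; exists x; rewrite //= permM permK.
  rewrite inE -imset_comp; apply: subset_trans; apply/subsetP => y /imsetP[x xe ->].
  by apply/imsetP; exists x; rewrite //= permM.
rewrite -card_draws mulnC -sum_nat_const.
transitivity (\sum_(e' in [set A : {set V} | #|A| == #|e|]) N e').
  by apply: eq_bigr => e'; rewrite inE => /eqP /Neq ->.
rewrite /N; under eq_bigr do rewrite -sum1_card big_mkcond.
rewrite exchange_big /= -sum_nat_const; apply: eq_bigr => s _.
rewrite -big_mkcondr /= sum1_card.
have im_inj : injective (fun A : {set V} => s @: A) by apply: imset_inj; apply: perm_inj.
rewrite -cards_draws -(card_imset _ im_inj); apply: eq_card => B; rewrite inE.
apply/imsetP/andP => [[A + ->]|[BS /eqP Be]].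
  by move=> /andP[]; rewrite !inE card_imset => [-> ->|]; last exact: perm_inj.
have sB : s @: ((s^-1)%g @: B) = B.
  rewrite -imset_comp -[RHS]imset_id; apply: eq_imset => x /=.
  by rewrite permKV.
exists ((s^-1)%g @: B); last by rewrite sB.
apply/andP; rewrite !inE sB card_imset ?Be //; exact: perm_inj.
Qed.

Lemma balanced_coloring_exists (V : finType) r M : #|V| = r * M ->
  exists c : V -> 'I_r, forall i, #|[set v | c v == i]| = M.
Proof.
move=> cV; have cP : #|{: 'I_r * 'I_M}| = #|V| by rewrite card_prod !card_ord.
pose p v : 'I_r * 'I_M := enum_val (cast_ord (esym cP) (enum_rank v)).
pose e x : V := enum_val (cast_ord cP (enum_rank x)).
have pe : cancel e p by move=> x; rewrite /p /e enum_valK cast_ordK enum_rankK.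
have ep : cancel p e by move=> v; rewrite /p /e enum_valK cast_ordKV enum_rankK.
exists (fun v => (p v).1) => i.
rewrite -[RHS]card_ord -cardsT -(card_imset (f := fun m => e (i, m))).
  apply: eq_card => v; rewrite !inE; apply/eqP/imsetP => [<-|[m _ ->]]; last by rewrite pe.
  by exists (p v).2 => //; rewrite -surjective_pairing ep.
by move=> m m' /(can_inj pe) [].
Qed.

(** A fixed balanced coloring is composed with a random permutation: a given edge gets a given color
    throughout with probability ['C(M, n) / 'C(#|V|, n)]. *)
Lemma first_moment_coloring (V : finType) (E : {set {set V}}) n r M :
  uniform n E -> #|V| = r * M -> #|E| * r * 'C(M, n) < 'C(#|V|, n) ->
  exists c : V -> 'I_r, equitable_coloring E c.
Proof.
move=> Eu cV lt; have [c cM] := balanced_coloring_exists cV.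
pose Bad (x : {set V} * 'I_r) := [set s : {perm V} | s @: x.1 \subset [set v | c v == x.2]].
have [s sgood] : exists s, s \notin \bigcup_(x | x.1 \in E) Bad x.
  have ltc : #|\bigcup_(x | x.1 \in E) Bad x| < #|{perm V}|.
    have cE : #|[pred x : {set V} * 'I_r | x.1 \in E]| = #|E| * r.
      rewrite -[r in RHS]card_ord -cardsT -cardsX; apply: eq_card => x.
      by rewrite !inE andbT.
    have C0 : 0 < 'C(#|V|, n) by apply: leq_ltn_trans lt.
    rewrite -(ltn_pmul2r C0).
    apply: leq_ltn_trans (_ : #|{perm V}| * (#|E| * r * 'C(M, n)) < _); last first.
      by rewrite ltn_pmul2l //; apply/card_gt0P; exists 1%g.
    apply: leq_trans (leq_mul (card_bigcup_le _ _) (leqnn _)) _.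
    rewrite big_distrl /= (eq_bigr (fun=> #|{perm V}| * 'C(M, n))).
      by rewrite sum_nat_const cE; move: #|{perm V}| 'C(M, n) #|E| => a b d; lia.
    by move=> x xE; rewrite -(Eu _ xE) card_perm_imset_sub cM.
  have : 0 < #|~: \bigcup_(x | x.1 \in E) Bad x| by rewrite cardsCs setCK subn_gt0.
  by case/card_gt0P=> s; rewrite inE; exists s.
exists (fun v => c (s v)); split=> [e eE [i ei]|i j].
  move/negP: sgood; apply; apply/bigcupP; exists (e, i) => //.
  by rewrite inE /=; apply/subsetP => y /imsetP[x xe ->]; rewrite inE ei.
have cl k : #|color_class (fun v => c (s v)) k| = M.
  rewrite /color_class -(cM k) -(card_imset _ (@perm_inj _ s)); apply: eq_card => y.
  rewrite inE; apply/imsetP/idP => [[x + ->]|cy]; first by rewrite inE.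
  by exists ((s^-1)%g y); rewrite ?inE permKV.
by rewrite !cl addn1 leqnSn.
Qed.

From Stdlib Require Import Reals Lra.

(** * The union bound *)

Lemma INR_expn a k : INR (expn a k) = (INR a ^ k)%R.
Proof. by elim: k => //= k IH; rewrite expnS mult_INR IH. Qed.

Lemma INR_muln a b : INR (a * b) = (INR a * INR b)%R.
Proof. exact: mult_INR. Qed.

Lemma INR_addn a b : INR (a + b) = (INR a + INR b)%R.
Proof. exact: plus_INR. Qed.

Lemma INR_leq a b : (a <= b)%N -> (INR a <= INR b)%R.
Proof. by move=> /leP; apply: le_INR. Qed.

Lemma leq_INR a b : (INR a <= INR b)%R -> (a <= b)%N.
Proof. by move=> /INR_le /leP. Qed.

Lemma INR_gt0 a : (0 < a)%N -> (0 < INR a)%R.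
Proof. by move=> /ltP; apply: lt_0_INR. Qed.

Section UnionBound.
Variables (V : finType) (E : {set {set V}}) (n r M kap q h T : nat) (W : R).
Hypothesis n_gt1 : 1 < n.
Hypothesis E_unif : uniform n E.
Hypothesis r_gt0 : 0 < r.
Hypothesis card_V : #|V| = r * M.
Hypothesis small_gaps : r.+1 * q + 2 * h < kap.

Variable K : nat.
Hypothesis K_def : K = r * kap.
Let L := kap - q.

(** The bound of [card_chain_within] on the probability that given [m.+1] edges form a chain with
    slack [Y] in a given window. *)
Definition chain_ratio m Y : R :=
  (INR 'C(m + Y, m) * INR (Y + m.+1 * L + m.+1) ^ (m.+1 * n)
    / (INR L.+1 ^ (2 * m) * INR m.+1 ^ (m.+1 * n) * INR K ^ (m.+1 * n - m)))%R.

Hypothesis short_le : (INR #|E| * INR n * (INR L / INR K) ^ n.-1 <= / 8)%R.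
Hypothesis r_chain_le : (INR #|E| ^ r * chain_ratio r.-1 (r * q) <= / 8)%R.
Hypothesis chain_le : forall m, m < r.-1 ->
  (INR #|E| ^ m.+1 * chain_ratio m (m.+1 * q + 2 * h) <= W)%R.
Hypothesis W_ge0 : (0 <= W)%R.
Hypothesis W_le : (INR r ^ 2 * W <= INR T.+1 / 8)%R.
Hypothesis KT_le : K * T <= h * #|V|.
Hypothesis deviation_le :
  (4 * INR r * INR #|V| * INR K ^ 2 <= INR (h * #|V| - K * T) ^ 2)%R.
Hypothesis D_gt0 : 0 < h * #|V| - K * T.

Let kap_gt0 : 0 < kap. Proof. lia. Qed.
Let K_gt0 : 0 < K. Proof. by rewrite K_def muln_gt0 r_gt0 kap_gt0. Qed.
Let INR_K_gt0 : (0 < INR K)%R. Proof. exact: INR_gt0. Qed.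
Let Om_gt0 : (0 < INR K ^ #|V|)%R. Proof. exact: pow_lt. Qed.

Lemma card_chain_ratio lo Y m (A : {ffun 'I_m.+1 -> {set V}}) :
  A \in ffun_on (mem E) ->
  (INR #|[set f : {ffun V -> 'I_K} | chain_within lo (Y + m.+1 * L) L A f]|
    <= chain_ratio m Y * INR K ^ #|V|)%R.
Proof.
move=> /ffun_onP AE; have := INR_leq (card_chain_within K lo Y L n_gt1
  (fun i => E_unif (AE i))).
rewrite !INR_muln !INR_expn /chain_ratio.
set c := INR #|_|; set a1 := (_ ^ (2 * m))%R; set a2 := (_ ^ _)%R; set a3 := (_ ^ (_ - m))%R.
have p1 : (0 < a1)%R by apply: pow_lt; apply: INR_gt0.
have p2 : (0 < a2)%R by apply: pow_lt; apply: INR_gt0.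
have p3 : (0 < a3)%R by apply: pow_lt.
have p : (0 < a1 * a2 * a3)%R by do 2!(apply: Rmult_lt_0_compat => //).
move=> le; apply: (Rmult_le_reg_r (a1 * a2 * a3)%R) => //.
have -> x y : (x / (a1 * a2 * a3) * y * (a1 * a2 * a3) = x * y)%R by field; lra.
by rewrite -!Rmult_assoc.
Qed.

Lemma INR_sum_le (I : finType) (P : pred I) (F : I -> nat) (c : R) :
  (forall i, P i -> (INR (F i) <= c)%R) ->
  (INR (\sum_(i | P i) F i) <= INR #|P| * c)%R.
Proof.
move=> Fc; rewrite -sum1_card.
elim/big_rec2: _ => [|i a b Pi IH]; first by rewrite /=; lra.
by rewrite !INR_addn /=; have := Fc i Pi; lra.
Qed.

Let weight := {ffun V -> 'I_K}.

Let B1 := [set f : weight | [exists e in E, short_edge L e f]].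
Let B2 := [set f : weight | chains E 0 (r.-1.+1 * q + 2 * 0 + r.-1.+1 * L) L r.-1 f != set0].
Let S (f : weight) := \sum_(i < r) \sum_(m < r.-1)
  #|chains E (i * kap - h) (m.+1 * q + 2 * h + m.+1 * L) L m f|.
Let B3 := [set f : weight | T < S f].
(** Shifting a cut by [h] changes the expected value of [K * cdf] by [h * #|V|]; [K * T] of this is
    reserved for color changes, and [D] remains for random deviation. *)
Let D := h * #|V| - K * T.
Let dev a := [set f : weight | (a * #|V| + D <= K * cdf a f) || (K * cdf a f + D <= a * #|V|)].
Let B4 := \bigcup_(j : 'I_r | 0 < j) (dev (j * kap - h) :|: dev (j * kap + h)).

Lemma card_B1 : (INR #|B1| <= / 8 * INR K ^ #|V|)%R.
Proof.
apply: Rle_trans (_ : (INR #|E| * (INR n * (INR L / INR K) ^ n.-1 * INR K ^ #|V|) <= _)%R); last first.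
  by rewrite -!Rmult_assoc; apply: Rmult_le_compat_r => //; lra.
apply: Rle_trans (_ : (INR (\sum_(e in E) #|[set f : weight | short_edge L e f]|) <= _)%R).
  apply: INR_leq; apply: leq_trans (card_bigcup_le _ _); apply: subset_leq_card.
  apply/subsetP => f; rewrite inE => /existsP[e /andP[eE se]].
  by apply/bigcupP; exists e => //; rewrite inE.
apply: INR_sum_le => e eE; have := E_unif eE; rewrite -{1}(prednK (ltnW n_gt1)) => en.
have := INR_leq (card_short_edge K L en).
rewrite prednK ?(ltnW n_gt1) // !INR_muln !INR_expn => le.
have pK := pow_lt _ n.-1 INR_K_gt0.
apply: (Rmult_le_reg_r (INR K ^ n.-1)) => //; apply: Rle_trans le _.
rewrite /Rdiv Rpow_mult_distr pow_inv.
by apply: Req_le; field; apply: Rgt_not_eq.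
Qed.

Lemma card_B2 : (INR #|B2| <= / 8 * INR K ^ #|V|)%R.
Proof.
apply: Rle_trans (_ : (INR #|E| ^ r * (chain_ratio r.-1 (r * q) * INR K ^ #|V|) <= _)%R); last first.
  by rewrite -Rmult_assoc; apply: Rmult_le_compat_r => //; lra.
apply: Rle_trans (_ : (INR (\sum_(A : {ffun 'I_r.-1.+1 -> {set V}} | A \in ffun_on (mem E))
  #|[set f : weight | chain_within 0 (r * q + r.-1.+1 * L) L A f]|) <= _)%R).
  apply: INR_leq; apply: leq_trans (card_bigcup_le _ _); apply: subset_leq_card.
  apply/subsetP => f; rewrite inE => /set0Pn[A]; rewrite inE => /andP[AE ch].
  by apply/bigcupP; exists A => //; rewrite inE; move: ch; rewrite muln0 addn0 {1}prednK.
have -> : (INR #|E| ^ r = INR #|[pred A : {ffun 'I_r.-1.+1 -> {set V}} | A \in ffun_on (mem E)]|)%R.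
  by rewrite -INR_expn card_ffun_on card_ord prednK.
by apply: INR_sum_le => A AE; apply: card_chain_ratio.
Qed.

(** Markov's inequality: [S] has mean at most [r ^ 2 * W], and [T < S f] means that it reaches
    [T.+1]. *)
Lemma card_B3 : (INR #|B3| <= / 8 * INR K ^ #|V|)%R.
Proof.
have T0 : (0 < INR T.+1)%R by apply: INR_gt0.
apply: (Rmult_le_reg_r (INR T.+1)) => //.
apply: Rle_trans (_ : (INR r ^ 2 * W * INR K ^ #|V| <= _)%R); last first.
  by have := Rmult_le_compat_r _ _ _ (Rlt_le _ _ Om_gt0) W_le; lra.
apply: Rle_trans (_ : (INR (\sum_(p : 'I_r * 'I_r.-1) \sum_(f : weight)
   #|chains E (p.1 * kap - h) (p.2.+1 * q + 2 * h + p.2.+1 * L) L p.2 f|) <= _)%R).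
  rewrite -INR_muln; apply: INR_leq.
  rewrite exchange_big -sum_nat_const big_mkcond /=.
  apply: leq_sum => f _; rewrite inE [X in _ <= X](_ : _ = S f); last by rewrite /S pair_big.
  by case: ifP.
have r2 : (INR #|{: 'I_r * 'I_r.-1}| <= INR r ^ 2)%R.
  rewrite card_prod !card_ord -INR_expn; apply: INR_leq.
  by rewrite expnS expn1 leq_mul2l leq_pred orbT.
have main (p : 'I_r * 'I_r.-1) : (INR (\sum_(f : weight)
   #|chains E (p.1 * kap - h) (p.2.+1 * q + 2 * h + p.2.+1 * L) L p.2 f|) <= W * INR K ^ #|V|)%R.
  case: p => i m /=.
  apply: Rle_trans (_ : (INR #|E| ^ m.+1 * (chain_ratio m (m.+1 * q + 2 * h) * INR K ^ #|V|) <= _)%R); last first.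
    by rewrite -Rmult_assoc; apply: Rmult_le_compat_r; [lra | apply: chain_le].
  have -> : \sum_(f : weight) #|chains E (i * kap - h) (m.+1 * q + 2 * h + m.+1 * L) L m f| =
    \sum_(A : {ffun 'I_m.+1 -> {set V}} | A \in ffun_on (mem E))
     #|[set f : weight | chain_within (i * kap - h) (m.+1 * q + 2 * h + m.+1 * L) L A f]|.
    under eq_bigr do rewrite -sum1_card big_mkcond.
    rewrite exchange_big /= [RHS]big_mkcond /=; apply: eq_bigr => A _.
    case: ifP => AE; last by rewrite big1 // => f _; rewrite in_set AE.
    by rewrite -sum1_card [RHS]big_mkcond; apply: eq_bigr => f _; rewrite !in_set AE.
  have -> : (INR #|E| ^ m.+1 = INR #|[pred A : {ffun 'I_m.+1 -> {set V}} | A \in ffun_on (mem E)]|)%R.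
    by rewrite -INR_expn card_ffun_on card_ord.
  by apply: INR_sum_le => A AE; apply: card_chain_ratio.
apply: Rle_trans (INR_sum_le (P := xpredT) (fun p _ => main p)) _.
rewrite Rmult_assoc; apply: Rmult_le_compat_r => //.
by apply: Rmult_le_pos => //; lra.
Qed.

(** There are at most [2 * r] thresholds, and by Chebyshev each fails with probability at most
    [1 / (4 * r)]. *)
Lemma card_B4 : (INR #|B4| <= / 2 * INR K ^ #|V|)%R.
Proof.
have D0 : (0 < INR D ^ 2)%R by apply: pow_lt; apply: INR_gt0.
apply: (Rmult_le_reg_r (INR D ^ 2)) => //.
apply: Rle_trans (_ : (INR r * (2 * INR #|V| * INR K ^ 2 * INR K ^ #|V|) <= _)%R); last first.
  by have := Rmult_le_compat_r _ _ _ (Rlt_le _ _ Om_gt0) deviation_le; rewrite -/D; lra.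
rewrite -INR_expn -INR_muln.
apply: (Rle_trans _ (INR (\sum_(j : 'I_r | 0 < j)
   (#|dev (j * kap - h)| + #|dev (j * kap + h)|) * expn D 2)%N)).
  apply: INR_leq; rewrite -big_distrl leq_mul2r; apply/orP; right.
  apply: leq_trans (card_bigcup_le _ _) _; apply: leq_sum => j _; exact: leq_card_setU.
apply: Rle_trans (INR_sum_le (c := 2 * INR #|V| * INR K ^ 2 * INR K ^ #|V|)%R _) _.
  move=> j j0; have jr := ltn_ord j.
  have le1 : j * kap - h <= K by rewrite K_def; nia.
  have le2 : j * kap + h <= K by rewrite K_def; nia.
  have := INR_leq (card_cdf_deviates V D le1).
  have := INR_leq (card_cdf_deviates V D le2).
  rewrite -/(dev (j * kap - h)) -/(dev (j * kap + h)).
  move: #|dev _| #|dev _| => d1 d2; rewrite mulnDl INR_addn !INR_muln !INR_expn; lra.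
apply: Rmult_le_compat_r.
  apply: Rmult_le_pos; last lra; apply: Rmult_le_pos; last by apply: pow_le; lra.
  by have := pos_INR #|V|; lra.
apply: INR_leq; apply: leq_trans (max_card _) _; by rewrite card_ord.
Qed.

(** The bad events have total probability at most [3 / 8 + 1 / 2 < 1], and a weight function outside
    them satisfies [good_weights_coloring]. *)
Theorem union_bound_coloring : exists c : V -> 'I_r, equitable_coloring E c.
Proof.
have [f fgood] : exists f : weight, f \notin B1 :|: B2 :|: B3 :|: B4.
  have : #|B1 :|: B2 :|: B3 :|: B4| < #|{: weight}|.
    rewrite ltnNge; apply/negP => /INR_leq; rewrite card_weights INR_expn => le.
    have c4 : #|B1 :|: B2 :|: B3 :|: B4| <= #|B1| + #|B2| + #|B3| + #|B4|.
      by do 3!(apply: leq_trans (leq_card_setU _ _) _; rewrite leq_add2r).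
    move/INR_leq: c4; rewrite !INR_addn.
    have := card_B1; have := card_B2; have := card_B3; have := card_B4; lra.
  move=> lt; have : 0 < #|~: (B1 :|: B2 :|: B3 :|: B4)| by rewrite cardsCs setCK subn_gt0.
  by case/card_gt0P=> f; rewrite inE; exists f.
move: fgood; rewrite !inE !negb_or -!andbA => /and4P[f1 f2 f3 f4].
have fdev j : 0 < j < r -> (f \notin dev (j * kap - h)) && (f \notin dev (j * kap + h)).
  move=> /andP[j0 jr]; rewrite -negb_or -in_setU; apply: contra f4 => fd.
  by apply/bigcupP; exists (Ordinal jr).
have KM : kap * #|V| = K * M by rewrite card_V K_def; lia.
apply: (@good_weights_coloring V E n r M kap q h T n_gt1 E_unif r_gt0 card_V small_gaps K f K_def).
- by move=> e eE; apply: contra f1 => se; apply/existsP; exists e; rewrite eE.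
- by apply/eqP; move: f2; rewrite negbK.
- by rewrite leqNgt.
- move=> j jr; have /andP[+ _] := fdev j jr; rewrite inE negb_or -!ltnNge => /andP[lt _].
  have hj : h <= j * kap by nia.
  have e1 : (j * kap - h) * #|V| + D = K * (j * M) - K * T.
    have : h * #|V| <= j * kap * #|V| by rewrite leq_mul2r hj orbT.
    by rewrite /D mulnBl; move: KT_le; nia.
  rewrite e1 in lt; rewrite -(leq_pmul2l K_gt0) mulnDr; lia.
- move=> j jr; have /andP[_ +] := fdev j jr; rewrite inE negb_or -!ltnNge => /andP[_ lt].
  have e1 : (j * kap + h) * #|V| = K * (j * M) + h * #|V| by nia.
  rewrite e1 /D in lt; rewrite -(leq_pmul2l K_gt0) mulnDr; lia.
Qed.

End UnionBound.

(** * Estimates *)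

Section Estimates.
Local Open Scope R_scope.

Lemma INR_subn (a b : nat) : (b <= a)%nat -> INR (a - b) = INR a - INR b.
Proof. by move=> /leP; apply: minus_INR. Qed.

Lemma pow_exp x k : exp x ^ k = exp (INR k * x).
Proof.
elim: k => [|k IH]; first by rewrite Rmult_0_l exp_0.
by rewrite [exp x ^ _]/= IH -exp_plus S_INR; congr exp; ring.
Qed.

Lemma exp_le x y : x <= y -> exp x <= exp y.
Proof. by case=> [/exp_increasing /Rlt_le|->]; [|apply: Rle_refl]. Qed.

(** The quotient of the factors [M - k] and [r * M - k] is at most [1 / r] times
    [1 - (r - 1) * k / (r * M)], hence at most [1 / r] times an exponential, and the exponents add
    up. For [k > M] truncated subtraction makes the left factor zero. *)
Lemma ffact_ratio r M k : (0 < r)%nat -> (k <= r * M)%nat ->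
  INR (M ^_ k) <= INR ((r * M) ^_ k) * (/ INR r) ^ k
     * exp (- ((INR r - 1) * (INR k * (INR k - 1)) / (2 * INR (r * M)))).
Proof.
move=> r0; elim: k => [|k IH] kN.
  by rewrite !ffactn0 /= Rmult_0_l Rmult_0_r /Rdiv Rmult_0_l Ropp_0 exp_0; lra.
have N0 : 0 < INR (r * M) by apply: INR_gt0; lia.
have r1 : 1 <= INR r by apply: (INR_leq (a := 1)).
have k0 := pos_INR k.
rewrite !ffactnSr (INR_muln (M ^_ k)) (INR_muln ((r * M) ^_ k)).
have step : INR (M - k) <= INR (r * M - k) * / INR r * exp (- ((INR r - 1) * INR k / INR (r * M))).
  have e0 := exp_pos (- ((INR r - 1) * INR k / INR (r * M))).
  case: (leqP k M) => kM; last first.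
    rewrite (_ : (M - k)%nat = 0%nat); last by lia.
    apply: Rmult_le_pos; last by lra.
    by apply: Rmult_le_pos; [apply: pos_INR | apply/Rlt_le/Rinv_0_lt_compat; lra].
  rewrite !INR_subn //; last by lia.
  have := exp_ineq1_le (- ((INR r - 1) * INR k / INR (r * M))) => le.
  have a0 : 0 <= INR (r * M) - INR k by have := INR_leq kN; rewrite S_INR; lra.
  apply: Rle_trans (_ : (INR (r * M) - INR k) * / INR r * (1 + - ((INR r - 1) * INR k / INR (r * M))) <= _).
    rewrite INR_muln in N0 *.
    have M0 : 0 < INR M by nra.
    have -> : (INR r * INR M - INR k) * / INR r * (1 + - ((INR r - 1) * INR k / (INR r * INR M)))
      = INR M - INR k + (INR r - 1) * (INR k * INR k) * / (INR r * INR r * INR M).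
      by field; lra.
    have : 0 <= (INR r - 1) * (INR k * INR k) * / (INR r * INR r * INR M).
      apply: Rmult_le_pos; first by nra.
      by apply/Rlt_le/Rinv_0_lt_compat; nra.
    lra.
  apply: Rmult_le_compat_l => //; apply: Rmult_le_pos => //.
  by apply/Rlt_le/Rinv_0_lt_compat; lra.
have {}IH := IH (ltnW kN).
apply: Rle_trans (Rmult_le_compat _ _ _ _ (pos_INR _) (pos_INR _) IH step) _.
rewrite S_INR.
have -> : - ((INR r - 1) * ((INR k + 1) * (INR k + 1 - 1)) / (2 * INR (r * M)))
 = - ((INR r - 1) * (INR k * (INR k - 1)) / (2 * INR (r * M))) + - ((INR r - 1) * INR k / INR (r * M)).
  by field; lra.
by rewrite exp_plus [(/ _) ^ _.+1]/=; apply: Req_le; ring.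
Qed.

Lemma nat_between a b : 0 <= a -> a + 1 <= b -> exists k : nat, a <= INR k <= b.
Proof.
move=> a0 ab; have [up1 up2] := archimed a.
have up0 : (0 <= up a)%Z by apply: le_IZR; lra.
by exists (Z.to_nat (up a)); rewrite INR_IZR_INZ Znat.Z2Nat.id //; lra.
Qed.

(** Each induction step costs a factor [(1 + 1 / m.+1) ^ m.+1], which is at most [exp 1]. *)
Lemma Sn_pow_le_fact m : INR m.+1 ^ m <= 3 ^ m * INR (m`!).
Proof.
elim: m => [|m IH]; first by rewrite /=; lra.
have m0 : 0 < INR m.+1 by apply: INR_gt0.
have h : INR m.+2 ^ m.+1 <= 3 * INR m.+1 ^ m.+1.
  have -> : INR m.+2 ^ m.+1 = (INR m.+2 / INR m.+1) ^ m.+1 * INR m.+1 ^ m.+1.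
    by rewrite -Rpow_mult_distr; congr (_ ^ _); field; lra.
  apply: Rmult_le_compat_r; first by apply: pow_le; lra.
  apply: Rle_trans (_ : exp (/ INR m.+1) ^ m.+1 <= _).
    apply: pow_incr; split; first by apply: Rmult_le_pos; [apply: pos_INR | apply/Rlt_le/Rinv_0_lt_compat].
    rewrite [INR m.+2]S_INR; move: (INR m.+1) m0 => t t0.
    have -> : (t + 1) / t = 1 + / t by field; lra.
    exact: exp_ineq1_le.
  rewrite pow_exp Rinv_r; last by lra.
  by apply: exp_le_3.
apply: Rle_trans h _; rewrite factS INR_muln -!tech_pow_Rmult.
have := Rmult_le_compat_l _ _ _ (Rlt_le _ _ m0) IH; lra.
Qed.

Lemma bin_le_pow a m : INR 'C(a, m) * INR (m`!) <= INR a ^ m.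
Proof.
rewrite -INR_muln bin_ffact -INR_expn; apply: INR_leq.
elim: m => [|m IH]; first by rewrite ffactn0.
by rewrite ffactnSr expnSr leq_mul // leq_subr.
Qed.

(** Put [N = r * M]. The hypothesis on [N] gives [n * (n - 1) / (2 * N) >= y / r], so the
    exponential gain from [ffact_ratio] cancels the power of [n / y], leaving the factor [0.01]. *)
Lemma first_moment_small (n r M : nat) (e : nat) :
  (1 < n)%nat -> (1 < r)%nat -> (n <= r * M)%nat -> 1 <= ln (INR n) ->
  INR e <= 0.01 * Rpower (INR n / ln (INR n)) ((INR r - 1) / INR r) * INR r ^ (n - 1) ->
  4 * ln (INR n) * INR (r * M) <= INR r * INR n ^ 2 ->
  (e * r * 'C(M, n) < 'C(r * M, n))%nat.
Proof.
move=> n1 r1 nN y1 eE small; set y := ln (INR n) in y1 eE small *.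
have n2 : 2 <= INR n by apply: (INR_leq (a := 2)).
have r2 : 2 <= INR r by apply: (INR_leq (a := 2)).
have N0 : 0 < INR (r * M) by apply: INR_gt0; lia.
set X := exp (- ((INR r - 1) * (INR n * (INR n - 1)) / (2 * INR (r * M)))).
have X0 : 0 < X by apply: exp_pos.
have rn0 : 0 < INR r ^ n by apply: pow_lt; lra.
have binle : INR 'C(M, n) * INR r ^ n <= INR 'C(r * M, n) * X.
  have := @ffact_ratio r M n (ltnW r1) nN; rewrite -!bin_ffact -/X.
  rewrite (INR_muln 'C(M, n)) (INR_muln 'C(r * M, n)) pow_inv => le.
  have f0 : 0 < INR (n`!) by apply: INR_gt0; apply: fact_gt0.
  apply: (Rmult_le_reg_r (INR (n`!))) => //.
  have := Rmult_le_compat_r _ _ _ (Rlt_le _ _ rn0) le.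
  have -> : INR 'C(r * M, n) * INR n`! * / INR r ^ n * X * INR r ^ n
     = INR 'C(r * M, n) * X * INR n`! by field; lra.
  lra.
have PX : Rpower (INR n / y) ((INR r - 1) / INR r) * X <= 1.
  rewrite /Rpower -exp_plus -[X in _ <= X]exp_0; apply: exp_le.
  have lny : ln (INR n / y) <= y.
    rewrite ln_mult ?ln_Rinv -/y; [|lra|lra|by apply: Rinv_0_lt_compat; lra].
    suff : 0 <= ln y by lra.
    rewrite -ln_1; case: y1 => [lt|<-]; last exact: Rle_refl.
    by apply/Rlt_le/ln_increasing; lra.
  have c0 : 0 <= (INR r - 1) / INR r.
    by apply: Rmult_le_pos; [lra | apply/Rlt_le/Rinv_0_lt_compat; lra].
  apply: Rle_trans (_ : (INR r - 1) / INR r * y +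
     - ((INR r - 1) * (INR n * (INR n - 1)) / (2 * INR (r * M))) <= _).
    by apply: Rplus_le_compat_r; apply: Rmult_le_compat_l.
  have -> : (INR r - 1) / INR r * y + - ((INR r - 1) * (INR n * (INR n - 1)) / (2 * INR (r * M)))
    = (INR r - 1) * / (2 * INR r * INR (r * M)) * (2 * y * INR (r * M) - INR r * (INR n * (INR n - 1))).
    by field; lra.
  have : 0 <= (INR r - 1) * / (2 * INR r * INR (r * M)).
    by apply: Rmult_le_pos; [lra | apply/Rlt_le/Rinv_0_lt_compat; nra].
  have : 2 * y * INR (r * M) - INR r * (INR n * (INR n - 1)) <= 0.
    have : 0 <= INR r * (INR n * (INR n - 2)) by apply: Rmult_le_pos; nra.
    by rewrite /= in small; lra.
  nra.
have C0 : 0 < INR 'C(r * M, n) by apply: INR_gt0; rewrite bin_gt0.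
rewrite ltnNge; apply/negP => /INR_leq; rewrite (INR_muln (e * r)) (INR_muln e) => le.
have rn : INR r ^ n = INR r ^ (n - 1) * INR r.
  by rewrite -{1}(subnK (ltnW n1)) addn1 /= Rmult_comm.
have r0 : 0 < INR r ^ (n - 1) by apply: pow_lt; lra.
set P := Rpower _ _ in eE PX.
have P0 : 0 < P by apply: exp_pos.
have h1 : INR e * INR r * INR 'C(M, n) <= 0.01 * P * X * INR 'C(r * M, n).
  have c0 := pos_INR 'C(M, n).
  apply: Rle_trans (_ : 0.01 * P * (INR 'C(M, n) * INR r ^ n) <= _).
    rewrite rn; have := Rmult_le_compat_r (INR r * INR 'C(M, n)) _ _ _ eE; nra.
  by have := Rmult_le_compat_l (0.01 * P) _ _ _ binle; nra.
have : 0.01 * P * X * INR 'C(r * M, n) <= 0.01 * INR 'C(r * M, n).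
  by apply: Rmult_le_compat_r; lra.
by lra.
Qed.

(** The large power has base [1 / r] times [1 + (2 * b + m.+1) / (m.+1 * kap)], which yields the
    exponential. The binomial gives a power over a factorial, and the factor 2 bounds
    [(kap / (kap - q).+1) ^ 2], at most [16 / 9]. *)
Lemma chain_ratio_le (n r kap q b m : nat) :
  (0 < n)%nat -> (0 < r)%nat -> (0 < kap)%nat -> (4 * q <= kap)%nat ->
  chain_ratio n kap q (r * kap) m (m.+1 * q + 2 * b) <=
    (/ INR r) ^ (m.+1 * n) * exp (INR n * (2 * INR b + INR m.+1) / INR kap)
    * (2 * INR r * (INR m.+1 * INR q + 2 * INR b + INR m.+1) / INR kap) ^ m / INR m`!.
Proof.
move=> n0 r0 kap0 qk.
have r0' : 0 < INR r by apply: INR_gt0.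
have k0 : 0 < INR m.+1 by apply: INR_gt0.
have kap0' : 0 < INR kap by apply: INR_gt0.
have f0 : 0 < INR m`! by apply: INR_gt0; apply: fact_gt0.
have L0 : 0 < INR (kap - q).+1 by apply: INR_gt0.
have b0 := pos_INR b; have q0 := pos_INR q; have n0' := pos_INR n.
rewrite /chain_ratio.
set k := INR m.+1 in k0 *; set Z := INR (_ + m.+1 * _ + _).
have ZE : Z = k * INR kap + 2 * INR b + k.
  rewrite /Z !INR_addn !INR_muln INR_subn; last by lia.
  by rewrite /k S_INR [INR 0]/=; ring.
have YE : INR (m + (m.+1 * q + 2 * b)) <= k * INR q + 2 * INR b + k.
  rewrite !INR_addn !INR_muln /k S_INR [INR 0]/=; lra.
have mk : (m <= m.+1 * n)%nat by nia.
set K := INR (r * kap); have KE : K = INR r * INR kap by rewrite /K INR_muln.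
have K0 : 0 < K by rewrite KE; apply: Rmult_lt_0_compat.
have -> : INR 'C(m + (m.+1 * q + 2 * b), m) * Z ^ (m.+1 * n) /
    (INR (kap - q).+1 ^ (2 * m) * k ^ (m.+1 * n) * K ^ (m.+1 * n - m)) =
    INR 'C(m + (m.+1 * q + 2 * b), m) * (Z / (k * K)) ^ (m.+1 * n)
     * (K / INR (kap - q).+1 ^ 2) ^ m.
  have eK : K ^ (m.+1 * n) = K ^ (m.+1 * n - m) * K ^ m by rewrite -pow_add; congr (_ ^ _); lia.
  rewrite /Rdiv !Rpow_mult_distr !pow_inv Rpow_mult_distr eK -pow_mult.
  have := pow_lt _ (m.+1 * n) k0; have := pow_lt _ m K0; have := pow_lt _ (m.+1 * n - m) K0.
  have := pow_lt _ (2 * m) L0.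
  have -> : (2 * m)%coq_nat = (2 * m)%nat by [].
  move=> *; field; lra.
have cC : INR 'C(m + (m.+1 * q + 2 * b), m) <= (k * INR q + 2 * INR b + k) ^ m / INR m`!.
  apply: (Rmult_le_reg_r (INR m`!)) => //.
  rewrite /Rdiv Rmult_assoc Rinv_l ?Rmult_1_r; last by lra.
  apply: Rle_trans (bin_le_pow _ _) _; apply: pow_incr; split=> //; exact: pos_INR.
have cZ : (Z / (k * K)) ^ (m.+1 * n) <= (/ INR r) ^ (m.+1 * n) *
    exp (INR n * (2 * INR b + k) / INR kap).
  have -> : INR n * (2 * INR b + k) / INR kap = INR (m.+1 * n) * ((2 * INR b + k) / (k * INR kap)).
    by rewrite INR_muln -/k; field; lra.
  rewrite -pow_exp -Rpow_mult_distr; apply: pow_incr; split.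
    apply: Rmult_le_pos; first by apply: pos_INR.
    by apply/Rlt_le/Rinv_0_lt_compat; apply: Rmult_lt_0_compat.
  have -> : Z / (k * K) = / INR r * (1 + (2 * INR b + k) / (k * INR kap)).
    by rewrite ZE KE; field; lra.
  apply: Rmult_le_compat_l; first by apply/Rlt_le/Rinv_0_lt_compat.
  exact: exp_ineq1_le.
have cL : (K / INR (kap - q).+1 ^ 2) ^ m <= (2 * INR r / INR kap) ^ m.
  apply: pow_incr; split.
    by apply: Rmult_le_pos; [lra | apply/Rlt_le/Rinv_0_lt_compat; apply: pow_lt].
  have L34 : 3 * INR kap <= 4 * INR (kap - q).+1.
    have h34 : (3 * kap <= 4 * (kap - q).+1)%nat by lia.
    have := INR_leq h34; rewrite (INR_muln 3) (INR_muln 4) [INR 3]/= [INR 4]/=; lra.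
  have l0 : 0 < INR (kap - q).+1 ^ 2 by apply: pow_lt.
  apply: (Rmult_le_reg_r (INR (kap - q).+1 ^ 2)) => //.
  rewrite /Rdiv Rmult_assoc Rinv_l ?Rmult_1_r; last by lra.
  apply: (Rmult_le_reg_r (INR kap)) => //; rewrite KE.
  have -> : 2 * INR r * / INR kap * INR (kap - q).+1 ^ 2 * INR kap = INR r * (2 * INR (kap - q).+1 ^ 2).
    by field; lra.
  rewrite Rmult_assoc; apply: Rmult_le_compat_l; first lra.
  move: (INR (kap - q).+1) L34 => l L34; rewrite /= Rmult_1_r; nra.
have p1 : 0 <= (Z / (k * K)) ^ (m.+1 * n).
  apply: pow_le; apply: Rmult_le_pos; first by apply: pos_INR.
  by apply/Rlt_le/Rinv_0_lt_compat; apply: Rmult_lt_0_compat.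
have p2 : 0 <= (K / INR (kap - q).+1 ^ 2) ^ m.
  apply: pow_le; apply: Rmult_le_pos; first lra.
  by apply/Rlt_le/Rinv_0_lt_compat; apply: pow_lt.
have := Rmult_le_compat _ _ _ _ _ _ (Rmult_le_compat _ _ _ _ (pos_INR _) p1 cC cZ) cL.
move=> /(_ (Rmult_le_pos _ _ (pos_INR _) p1) p2) h; apply: Rle_trans h _.
apply: Req_le; rewrite /Rdiv !Rpow_mult_distr; ring.
Qed.

Lemma pow_ratio_le (e c x : R) (n k : nat) : (0 < n)%nat -> 0 < x -> 0 <= e ->
  e <= c * x ^ (n - 1) -> e ^ k * (/ x) ^ (k * n) <= (c / x) ^ k.
Proof.
move=> n0 x0 e0 le; rewrite mulnC -[(n * k)%nat]/(Nat.mul n k) pow_mult -Rpow_mult_distr.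
apply: pow_incr; split; first by apply: Rmult_le_pos => //; apply/pow_le/Rlt_le/Rinv_0_lt_compat.
have xn : 0 < x ^ (n - 1) by apply: pow_lt.
have -> : c / x = c * x ^ (n - 1) * (/ x) ^ n.
  rewrite -{2}(subnK n0) addn1 pow_inv /=; field; lra.
by apply: Rmult_le_compat_r => //; apply/pow_le/Rlt_le/Rinv_0_lt_compat.
Qed.

Lemma exp_ge_pow4 x : 0 <= x -> (x / 4) ^ 4 <= exp x.
Proof.
move=> x0; have -> : exp x = exp (x / 4) ^ 4 by rewrite pow_exp; congr exp; rewrite /=; field.
by apply: pow_incr; split; [lra | have := exp_ineq1_le (x / 4); lra].
Qed.

(** * Many vertices: choice of the parameters *)

Section LargeCase.
(** With [s] the tenth root of [ln n], the bound on [r] is [s ^ 2] and the square root of [y] is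
    [s ^ 5], so growth rates are compared through integer powers of [s]. *)
Variables (V : finType) (E : {set {set V}}) (n r M : nat) (s : R).
Hypothesis s_ge : 100 <= s.
Hypothesis n_def : INR n = exp (s ^ 10).
Hypothesis r_gt1 : (1 < r)%nat.
Hypothesis r_lt : INR r < s ^ 2.
Hypothesis E_unif : uniform n E.
Hypothesis card_V : #|V| = (r * M)%nat.

Let y := s ^ 10.
Let P := Rpower (INR n / y) ((INR r - 1) / INR r).
Hypothesis card_E : INR #|E| <= 0.01 * P * INR r ^ (n - 1).
Hypothesis large : INR r * INR n ^ 2 < 4 * y * INR #|V|.

Let Lam := ln (INR n / y).

Lemma spow i j : (i <= j)%nat -> s ^ i <= s ^ j.
Proof. by move=> /leP; apply: Rle_pow; lra. Qed.

Lemma spowS i : 100 * s ^ i <= s ^ i.+1.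
Proof.
rewrite -tech_pow_Rmult; apply: Rmult_le_compat_r; [apply: pow_le|]; lra.
Qed.

Lemma s_ge1 i : 1 <= s ^ i.
Proof. by apply: pow_R1_Rle; lra. Qed.

Lemma n_ge : s ^ 13 <= INR n.
Proof.
rewrite n_def; apply: Rle_trans (exp_ge_pow4 (Rle_trans _ _ _ Rle_0_1 (s_ge1 10))).
have -> : (s ^ 10 / 4) ^ 4 = s ^ 38 * (s ^ 2 / 256) by field.
have h := s_ge1 38; have h2 : 1 <= s ^ 2 / 256 by rewrite /=; nra.
apply: Rle_trans (spow (j := 38) _) _ => //.
by rewrite -{1}[s ^ 38]Rmult_1_r; apply: Rmult_le_compat_l; lra.
Qed.

Lemma y_ge : 100 <= y.
Proof. by have := spowS 9; have := s_ge1 9; rewrite /y; lra. Qed.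

Lemma n_gt1 : (1 < n)%nat.
Proof.
apply: leq_INR; have := n_ge; have := s_ge1 12; have := spowS 12.
by rewrite [INR 2]/=; lra.
Qed.

Lemma r_ge2 : 2 <= INR r.
Proof. exact: (INR_leq (a := 2)). Qed.

Lemma N_gt0 : 0 < INR #|V|.
Proof.
have := large; have := r_ge2; have := n_ge; have := s_ge1 13; have := y_ge; rewrite /=.
move=> *; have : 0 < INR r * (INR n * (INR n * 1)) by apply: Rmult_lt_0_compat; nra.
nra.
Qed.

Lemma exp_Lam : exp Lam = INR n / y.
Proof.
rewrite exp_ln //; have := n_ge; have := s_ge1 13; have := y_ge => *.
by apply: Rmult_lt_0_compat; [lra | apply: Rinv_0_lt_compat; lra].
Qed.

Lemma Lam_bounds : 0 <= Lam <= y.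
Proof.
have y0 := y_ge; have n0 := n_ge; have yn : y <= INR n.
  by apply: Rle_trans n0; apply: spow.
split.
  rewrite -ln_1 /Lam; case: (Req_dec (INR n / y) 1) => [->|ne]; first exact: Rle_refl.
  have h : 1 <= INR n / y.
    by apply: (Rmult_le_reg_r y); [lra | rewrite /Rdiv Rmult_assoc Rinv_l; lra].
  by apply/Rlt_le/ln_increasing; lra.
apply: Rnot_lt_le => /exp_increasing; rewrite exp_Lam -/y -n_def -/y.
move=> lt; have : INR n / y <= INR n.
  apply: (Rmult_le_reg_r y); first lra.
  by rewrite /Rdiv Rmult_assoc Rinv_l; nra.
lra.
Qed.

Lemma PE : P = exp ((INR r - 1) / INR r * Lam).
Proof. by []. Qed.

Lemma P_le_n : P <= INR n.
Proof.
rewrite PE n_def -/y; apply: exp_le; have [l0 ly] := Lam_bounds; have := r_ge2 => r2.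
have : (INR r - 1) / INR r <= 1.
  by apply: (Rmult_le_reg_r (INR r)); [lra | rewrite /Rdiv Rmult_assoc Rinv_l; lra].
have : 0 <= (INR r - 1) / INR r.
  by apply: Rmult_le_pos; [lra | apply/Rlt_le/Rinv_0_lt_compat; lra].
rewrite -/y; nra.
Qed.

(** The scale of the cut windows as a fraction of the whole weight range; in vertices it is
    [delta * #|V| = sqrt (r * #|V|)]. *)
Definition delta := sqrt (INR r / INR #|V|).

Lemma delta_gt0 : 0 < delta.
Proof.
apply: sqrt_lt_R0; have := r_ge2; have := N_gt0 => *.
by apply: Rmult_lt_0_compat; [lra | apply: Rinv_0_lt_compat].
Qed.

Lemma delta_sq : delta * delta * INR #|V| = INR r.
Proof.
have N0 := N_gt0; have r2 := r_ge2; rewrite sqrt_sqrt; first by field; lra.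
by apply: Rmult_le_pos; [lra | apply/Rlt_le/Rinv_0_lt_compat].
Qed.

(** The lower bound [large] on the number of vertices says that [(delta * n) ^ 2 < 4 * y]. *)
Lemma delta_n : delta * INR n <= 2 * s ^ 5.
Proof.
have d0 := delta_gt0; have N0 := N_gt0; have n0 := n_ge; have s13 := s_ge1 13.
have s5 := s_ge1 5.
apply: Rnot_lt_le => lt.
have lt2 : 2 * s ^ 5 * (2 * s ^ 5) < delta * INR n * (delta * INR n).
  by apply: Rmult_le_0_lt_compat; lra.
have e1 : 2 * s ^ 5 * (2 * s ^ 5) = 4 * y by rewrite /y; ring.
have := large; have e2 : INR r * INR n ^ 2 = delta * INR n * (delta * INR n) * INR #|V|.
  by rewrite -delta_sq; ring.
rewrite e2 -e1 => lt3; have := Rmult_lt_compat_r _ _ _ N0 lt2; lra.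
Qed.

(** The discretization must be fine: [n * n] keeps the rounding error [n * r / kap] at most 1, and
    [#|V|] makes the windows at least one unit wide. *)
Let kap := (n * n + #|V|)%nat.

Lemma kap_ge : INR n * INR n <= INR kap /\ INR #|V| <= INR kap.
Proof.
rewrite /kap INR_addn INR_muln; have := pos_INR #|V|; have := pos_INR n; split; nra.
Qed.

Lemma large_case_coloring : exists c : V -> 'I_r, equitable_coloring E c.
Proof.
have [kn kN] := kap_ge; have n0 := n_ge; have s13 := s_ge1 13; have y0 := y_ge.
have n1 := n_gt1; have r2 := r_ge2; have N0 := N_gt0; have d0 := delta_gt0.
have dn := delta_n; have dsq := delta_sq; have [L0 Ly] := Lam_bounds.
have r_gt0 : (0 < r)%nat := ltnW r_gt1.
have kap0 : 0 < INR kap by lra.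
have kap0' : (0 < kap)%nat by apply/ltP/INR_lt; rewrite [INR 0]/=.
have yn0 : 0 < y / INR n by apply: Rmult_lt_0_compat; [lra | apply: Rinv_0_lt_compat; lra].
have ynk : 100 <= y / INR n * INR kap.
  apply: Rle_trans (_ : y / INR n * (INR n * INR n) <= _); last by apply: Rmult_le_compat_l; lra.
  have -> : y / INR n * (INR n * INR n) = y * INR n by field; lra.
  nra.
(* The factor [5 / 2] ensures [(n - 1) * q / kap >= 2 * y], which makes short edges unlikely enough;
   the upper factor leaves room for rounding. *)
have [q [q1 q2]] : exists q : nat, 5 / 2 * (y / INR n * INR kap) <= INR q <= 3 * (y / INR n * INR kap).
  by apply: nat_between; lra.
have dk : 1 <= INR r * delta * INR kap.
  apply: Rnot_lt_le => lt.
  have h1 : INR r * delta * INR kap * (INR r * delta * INR kap) < 1 * 1.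
    by apply: Rmult_le_0_lt_compat; try lra; apply: Rmult_le_pos; nra.
  have : 1 <= INR kap by nra.
  have : INR r * INR r * (INR r * INR kap) * 1 <= INR r * delta * INR kap * (INR r * delta * INR kap).
    apply: Rle_trans (_ : INR r * INR r * INR kap * (delta * delta * INR #|V|) <= _).
      by rewrite dsq; lra.
    have : 0 <= INR r * INR r * INR kap * (delta * delta).
      by apply: Rmult_le_pos; [nra | nra].
    nra.
  have : 8 <= INR r * INR r * INR r by nra.
  nra.
(* The factor 4 is set by Chebyshev: half of [h * #|V|] is at least [2 * delta * K * #|V|], whose
   square is the required [4 * r * #|V| * K ^ 2]. The other half is given to [T]. *)
have [h [h1 h2]] : exists h : nat, 4 * (INR r * delta * INR kap) <= INR h <= 5 * (INR r * delta * INR kap).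
  by apply: nat_between; lra.
pose K := (r * kap)%nat.
have KE : INR K = INR r * INR kap by rewrite /K INR_muln.
pose T := ((h * #|V|) %/ (2 * K))%nat.
(* Here [s ^ 10 - s ^ 8] bounds [y - y / r], [20 * s ^ 7] pays for the width of the windows,
   [8 * s ^ 6] for the powers of [8 * r ^ 2], and 1 for discretization. *)
pose W := exp (s ^ 10 - s ^ 8 + 20 * s ^ 7 + 8 * s ^ 6 + 1).
have qk : INR q / INR kap <= 3 * (y / INR n).
  by apply: (Rmult_le_reg_r (INR kap)) => //; rewrite /Rdiv Rmult_assoc Rinv_l; lra.
have hk : INR h / INR kap <= 5 * (INR r * delta).
  by apply: (Rmult_le_reg_r (INR kap)) => //; rewrite /Rdiv Rmult_assoc Rinv_l; lra.
have K_gt0 : (0 < K)%nat by rewrite muln_gt0 r_gt0.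
have K0 : 0 < INR K by apply: INR_gt0.
have T1 : (2 * K * T <= h * #|V|)%nat by rewrite mulnC leq_trunc_div.
have T2 : (h * #|V| < 2 * K * T.+1)%nat by rewrite (mulnC (2 * K)%nat); apply: ltn_ceil; rewrite muln_gt0.
have h_gt0 : (0 < h)%nat by apply/ltP/INR_lt; rewrite [INR 0]/=; lra.
have V_gt0 : (0 < #|V|)%nat by apply/ltP/INR_lt; rewrite [INR 0]/=.
have hV : (0 < h * #|V|)%nat by rewrite muln_gt0 h_gt0.
have n_s : 23 * s ^ 12 < INR n by have := spowS 12; have := s_ge1 12; lra.
have y_n : y / INR n <= 1 / 12 / s ^ 2.
  have s2 := s_ge1 2; have s12 := s_ge1 12.
  apply: (Rmult_le_reg_r (INR n * s ^ 2)); first by apply: Rmult_lt_0_compat; lra.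
  have -> : y / INR n * (INR n * s ^ 2) = s ^ 12 by rewrite /y; field; lra.
  have -> : 1 / 12 / s ^ 2 * (INR n * s ^ 2) = INR n / 12 by field; lra.
  lra.
have d_n : delta <= 2 * (s ^ 5 / INR n).
  apply: (Rmult_le_reg_r (INR n)); first lra.
  by have -> : 2 * (s ^ 5 / INR n) * INR n = 2 * s ^ 5 by field; lra.
have s57 : s ^ 5 / INR n <= / 23 / s ^ 7.
  have s7 := s_ge1 7.
  apply: (Rmult_le_reg_r (INR n * s ^ 7)); first by apply: Rmult_lt_0_compat; lra.
  have -> : s ^ 5 / INR n * (INR n * s ^ 7) = s ^ 12 by field; lra.
  have -> : / 23 / s ^ 7 * (INR n * s ^ 7) = INR n / 23 by field; lra.
  lra.
have small_gaps : (r.+1 * q + 2 * h < kap)%nat.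
  apply/ltP/INR_lt; rewrite INR_addn !INR_muln S_INR [INR 2]/=.
  have e1 : INR q = INR q / INR kap * INR kap by field; lra.
  have e2 : INR h = INR h / INR kap * INR kap by field; lra.
  rewrite e1 e2.
  suff : (INR r + 1) * (INR q / INR kap) + 2 * (INR h / INR kap) < 1 by nra.
  have s2 := s_ge1 2; have r1 : INR r + 1 <= 2 * s ^ 2 by lra.
  have b1 : (INR r + 1) * (INR q / INR kap) <= 1 / 2.
    apply: Rle_trans (_ : 2 * s ^ 2 * (3 * (1 / 12 / s ^ 2)) <= _).
      apply: Rmult_le_compat; [lra | | lra | lra].
      by apply: Rmult_le_pos; [apply: pos_INR | apply/Rlt_le/Rinv_0_lt_compat].
    by apply: Req_le; field; lra.
  have b2 : 2 * (INR h / INR kap) <= 20 / 23 / s ^ 5.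
    apply: Rle_trans (_ : 10 * (s ^ 2 * (2 * (/ 23 / s ^ 7))) <= _).
      have : INR r * delta <= s ^ 2 * (2 * (/ 23 / s ^ 7)) by apply: Rmult_le_compat; lra.
      lra.
    by apply: Req_le; field; lra.
  have b3 : 20 / 23 / s ^ 5 <= 1 / 10.
    have s5 : 100 <= s ^ 5 by have := spowS 4; have := s_ge1 4; lra.
    apply: (Rmult_le_reg_r (s ^ 5)); first lra.
    have -> : 20 / 23 / s ^ 5 * s ^ 5 = 20 / 23 by field; lra.
    lra.
  lra.
have q4 : (4 * q <= kap)%nat.
  apply: leq_INR; rewrite INR_muln [INR 4]/=.
  have s2 := s_ge1 2.
  have : 1 / 12 / s ^ 2 <= 1 / 12.
    apply: (Rmult_le_reg_r (s ^ 2)); first lra.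
    have -> : 1 / 12 / s ^ 2 * s ^ 2 = 1 / 12 by field; lra.
    lra.
  by move=> le; have : y / INR n * INR kap <= 1 / 12 * INR kap; [apply: Rmult_le_compat_r; lra | lra].
have rn : INR r <= INR n.
  by have := spow (i := 2) (j := 13) isT; lra.
have nk k : INR k <= INR r -> INR n * INR k / INR kap <= 1.
  move=> kr; apply: (Rmult_le_reg_r (INR kap)) => //.
  rewrite /Rdiv Rmult_assoc Rinv_l; last lra.
  by rewrite Rmult_1_r Rmult_1_l; apply: Rle_trans kn; apply: Rmult_le_compat_l; lra.
have base_le k b : INR k <= INR r -> INR b <= INR h ->
    2 * INR r * (INR k * INR q + 2 * INR b + INR k) / INR kap <= 8 * INR r ^ 2 * (y / INR n).
  move=> kr bh.
  have e1 : INR k * (INR q / INR kap) <= INR r * (3 * (y / INR n)).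
    apply: Rmult_le_compat => //; first exact: pos_INR.
    by apply: Rmult_le_pos; [apply: pos_INR | apply/Rlt_le/Rinv_0_lt_compat].
  have e2 : INR b / INR kap <= 10 * (INR r * (s ^ 5 / INR n)).
    apply: Rle_trans (_ : INR h / INR kap <= _).
      by apply: Rmult_le_compat_r => //; apply/Rlt_le/Rinv_0_lt_compat.
    have : INR r * delta <= INR r * (2 * (s ^ 5 / INR n)) by apply: Rmult_le_compat_l; lra.
    lra.
  have e3 : INR k / INR kap <= INR r * / INR n.
    apply: Rmult_le_compat => //; first exact: pos_INR.
      by apply/Rlt_le/Rinv_0_lt_compat.
    by apply: Rinv_le_contravar; [lra | nra].
  have e4 : 20 * (s ^ 5 / INR n) + / INR n <= y / INR n.
    have -> : 20 * (s ^ 5 / INR n) + / INR n = (20 * s ^ 5 + 1) / INR n by field; lra.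
    apply: Rmult_le_compat_r; first by apply/Rlt_le/Rinv_0_lt_compat; lra.
    have := spow (i := 6) (j := 10) isT; have := spowS 5; have := s_ge1 5; rewrite /y; lra.
  have -> : 2 * INR r * (INR k * INR q + 2 * INR b + INR k) / INR kap
    = 2 * INR r * (INR k * (INR q / INR kap) + 2 * (INR b / INR kap) + INR k / INR kap).
    by field; lra.
  have -> : 8 * INR r ^ 2 * (y / INR n) = 2 * INR r * (INR r * (4 * (y / INR n))) by ring.
  apply: Rmult_le_compat_l; first lra.
  have : INR r * (20 * (s ^ 5 / INR n) + / INR n) <= INR r * (y / INR n).
    by apply: Rmult_le_compat_l; lra.
  lra.
have base_ge0 k b : 0 <= 2 * INR r * (INR k * INR q + 2 * INR b + INR k) / INR kap.
  apply: Rmult_le_pos; last by apply/Rlt_le/Rinv_0_lt_compat.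
  apply: Rmult_le_pos; first lra.
  by have := pos_INR k; have := pos_INR q; have := pos_INR b; nra.
have P0 : 0 < P by apply: exp_pos.
(* Each edge contributes [0.01 * P / r] and each of the [m] junctions [8 * r ^ 2 * y / n]. *)
have term m b : (m < r)%nat -> INR b <= INR h ->
  INR #|E| ^ m.+1 * chain_ratio n kap q K m (m.+1 * q + 2 * b) <=
   (0.01 * P / INR r) ^ m.+1 * exp (INR n * (2 * INR b) / INR kap + 1)
     * (8 * INR r ^ 2 * (y / INR n)) ^ m / INR m`!.
  move=> mr bh; have kr : INR m.+1 <= INR r by apply: INR_leq.
  have f0 : 0 < INR m`! by apply: INR_gt0; apply: fact_gt0.
  apply: Rle_trans (Rmult_le_compat_l _ _ _ (pow_le _ _ (pos_INR _))
     (chain_ratio_le b m (ltnW n1) r_gt0 kap0' q4)) _.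
  have pr := @pow_ratio_le _ _ _ n m.+1 (ltnW n1) (INR_gt0 r_gt0) (pos_INR _) card_E.
  set A := exp _; set B := (_ / INR kap) ^ m.
  have -> : INR #|E| ^ m.+1 * ((/ INR r) ^ (m.+1 * n) * A * B / INR m`!)
    = INR #|E| ^ m.+1 * (/ INR r) ^ (m.+1 * n) * A * B * / INR m`! by rewrite /Rdiv; ring.
  apply: Rmult_le_compat_r; first by apply/Rlt_le/Rinv_0_lt_compat.
  have A0 : 0 < A by apply: exp_pos.
  have r0 : 0 <= (/ INR r) ^ (m.+1 * n) by apply/pow_le/Rlt_le/Rinv_0_lt_compat; lra.
  have E0 : 0 <= INR #|E| ^ m.+1 by apply/pow_le/pos_INR.
  apply: Rmult_le_compat.
  - by apply: Rmult_le_pos; [apply: Rmult_le_pos | lra].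
  - by apply: pow_le; apply: base_ge0.
  - apply: Rmult_le_compat => //; [by apply: Rmult_le_pos | lra |].
    apply: exp_le; have := nk _ kr.
    have -> : INR n * (2 * INR b + INR m.+1) / INR kap
      = INR n * (2 * INR b) / INR kap + INR n * INR m.+1 / INR kap by field; lra.
    lra.
  - by apply: pow_incr; split; [apply: base_ge0 | apply: base_le].
have ynL : y / INR n = exp (- Lam).
  by rewrite exp_Ropp exp_Lam; field; lra.
(* The exponent [(r - 1) / r] is made for this: [r] edges against [r - 1] junctions cancel all
   powers of [n / y]. *)
have PrE : P ^ r = (INR n / y) ^ r.-1.
  rewrite PE -exp_Lam !pow_exp; congr exp.
  have -> : INR r.-1 = INR r - 1 by rewrite -[in RHS](prednK r_gt0) S_INR; lra.
  by field; lra.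
have KTV : INR K * INR T <= INR h * INR #|V| / 2.
  by have := INR_leq T1; rewrite !INR_muln [INR 2]/=; lra.
have DE : INR (h * #|V| - K * T) = INR h * INR #|V| - INR K * INR T.
  by rewrite INR_subn ?INR_muln //; lia.
have hV0 : 0 < INR h * INR #|V| by have := INR_gt0 hV; rewrite INR_muln.
apply: (@union_bound_coloring V E n r M kap q h T W n1 E_unif r_gt0 card_V small_gaps K erefl).
- have c1 : INR (kap - q) / INR K <= / INR r * exp (- (INR q / INR kap)).
    rewrite INR_subn; last by lia.
    have -> : (INR kap - INR q) / INR K = / INR r * (1 + - (INR q / INR kap)).
      by rewrite KE; field; lra.
    apply: Rmult_le_compat_l; first by apply/Rlt_le/Rinv_0_lt_compat; lra.
    exact: exp_ineq1_le.
  have c2 : (INR (kap - q) / INR K) ^ n.-1 <= (/ INR r) ^ n.-1 * exp (- (2 * y)).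
    apply: Rle_trans (pow_incr _ _ n.-1 (conj _ c1)) _.
      by apply: Rmult_le_pos; [apply: pos_INR | apply/Rlt_le/Rinv_0_lt_compat].
    rewrite Rpow_mult_distr; apply: Rmult_le_compat_l.
      by apply/pow_le/Rlt_le/Rinv_0_lt_compat; lra.
    rewrite pow_exp; apply: exp_le.
    have -> : INR n.-1 = INR n - 1 by rewrite -[in RHS](prednK (ltnW n1)) S_INR; lra.
    have q1' : 5 / 2 * (y / INR n) <= INR q / INR kap.
      by apply: (Rmult_le_reg_r (INR kap)) => //; rewrite /Rdiv [X in _ <= X]Rmult_assoc Rinv_l; lra.
    have : (INR n - 1) * (5 / 2 * (y / INR n)) <= (INR n - 1) * (INR q / INR kap).
      by apply: Rmult_le_compat_l; lra.
    have -> : (INR n - 1) * (5 / 2 * (y / INR n)) = 5 / 2 * y - 5 / 2 * (y / INR n) by field; lra.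
    have : y / INR n <= 1.
      apply: Rle_trans y_n _; have s2 := s_ge1 2.
      apply: (Rmult_le_reg_r (s ^ 2)); first lra.
      have -> : 1 / 12 / s ^ 2 * s ^ 2 = 1 / 12 by field; lra.
      lra.
    lra.
  have rn0 : 0 < (/ INR r) ^ n.-1 by apply: pow_lt; apply: Rinv_0_lt_compat; lra.
  have c3 : INR #|E| * (/ INR r) ^ n.-1 <= 0.01 * P.
    apply: Rle_trans (Rmult_le_compat_r _ _ _ (Rlt_le _ _ rn0) card_E) _.
    rewrite subn1 pow_inv Rmult_assoc Rinv_r; first lra.
    by apply: pow_nonzero; lra.
  (* As [exp y = n], the product is exactly [0.01]. *)
  apply: Rle_trans (_ : INR n * (0.01 * INR n) * exp (- (2 * y)) <= _).
    have -> : INR #|E| * INR n * (INR (kap - q) / INR K) ^ n.-1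
      = INR n * (INR #|E| * (INR (kap - q) / INR K) ^ n.-1) by ring.
    rewrite Rmult_assoc; apply: Rmult_le_compat_l; first lra.
    apply: Rle_trans (Rmult_le_compat_l _ _ _ (pos_INR _) c2) _.
    rewrite -Rmult_assoc; apply: Rmult_le_compat_r; first by apply/Rlt_le/exp_pos.
    by have := P_le_n; lra.
  have -> : INR n * (0.01 * INR n) * exp (- (2 * y)) = 0.01 * (exp y * exp y * exp (- (2 * y))).
    by rewrite n_def -/y; ring.
  rewrite -!exp_plus (_ : y + y + - (2 * y) = 0); last ring.
  by rewrite exp_0; lra.
- have b0 : INR 0 <= INR h by rewrite [INR 0]/=; apply: pos_INR.
  have pr : (r.-1 < r)%nat by lia.
  have := term r.-1 0%nat pr b0; rewrite prednK // muln0 addn0 [INR 0]/= => le.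
  apply: Rle_trans le _.
  have f0 : 0 < INR (r.-1)`! by apply: INR_gt0; apply: fact_gt0.
  have -> : INR n * (2 * 0) / INR kap + 1 = 1 by field; lra.
  have -> : (0.01 * P / INR r) ^ r = (0.01 / INR r) ^ r * P ^ r.
    by rewrite -Rpow_mult_distr; congr (_ ^ _); field; lra.
  rewrite PrE.
  have -> : (0.01 / INR r) ^ r * (INR n / y) ^ r.-1 * exp 1 *
     (8 * INR r ^ 2 * (y / INR n)) ^ r.-1 / INR (r.-1)`!
    = exp 1 * ((0.01 / INR r) ^ r * ((8 * INR r ^ 2) ^ r.-1 / INR (r.-1)`!)).
    have -> : (8 * INR r ^ 2 * (y / INR n)) ^ r.-1 = (8 * INR r ^ 2) ^ r.-1 * (y / INR n) ^ r.-1.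
      by rewrite Rpow_mult_distr.
    have e1 : (INR n / y) ^ r.-1 * (y / INR n) ^ r.-1 = 1.
      by rewrite -Rpow_mult_distr (_ : INR n / y * (y / INR n) = 1) ?pow1 //; field; lra.
    transitivity (exp 1 * ((0.01 / INR r) ^ r * ((8 * INR r ^ 2) ^ r.-1 / INR (r.-1)`!))
      * ((INR n / y) ^ r.-1 * (y / INR n) ^ r.-1)).
      move: ((INR n / y) ^ _) ((y / INR n) ^ _) ((0.01 / _) ^ _) ((8 * _) ^ _) (exp 1).
      by move=> *; rewrite /Rdiv; ring.
    by rewrite e1 Rmult_1_r.
  (* With [r ^ r.-1] at most [3 ^ r.-1] times the factorial, the base becomes [0.24], so the total
     is at most [0.01 * exp 1]. *)
  have -> : (0.01 / INR r) ^ r * ((8 * INR r ^ 2) ^ r.-1 / INR (r.-1)`!)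
    = 0.01 / INR r * (0.08 ^ r.-1 * (INR r ^ r.-1 / INR (r.-1)`!)).
    have -> : (0.01 / INR r) ^ r = 0.01 / INR r * (0.01 / INR r) ^ r.-1.
      by rewrite -{2}(prednK r_gt0).
    rewrite /Rdiv [X in X = _]Rmult_assoc; congr (_ * _).
    rewrite -!Rmult_assoc -!Rpow_mult_distr; congr (_ ^ _ * _).
    rewrite (_ : 0.08 = 8 * 0.01); last lra.
    by move: 0.01 => d; field; lra.
  have f3 : INR r ^ r.-1 / INR (r.-1)`! <= 3 ^ r.-1.
    have := Sn_pow_le_fact r.-1; rewrite prednK // => le.
    apply: (Rmult_le_reg_r (INR (r.-1)`!)) => //.
    by rewrite /Rdiv Rmult_assoc Rinv_l; lra.
  have f4 : 0.08 ^ r.-1 * (INR r ^ r.-1 / INR (r.-1)`!) <= 1.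
    apply: Rle_trans (Rmult_le_compat_l _ _ _ _ f3) _; first by apply: pow_le; lra.
    rewrite -Rpow_mult_distr -(pow1 r.-1); apply: pow_incr; lra.
  have f5 : 0 < 0.01 / INR r <= 0.01.
    split; first by apply: Rmult_lt_0_compat; [lra | apply: Rinv_0_lt_compat; lra].
    by apply: (Rmult_le_reg_r (INR r)); [lra | rewrite /Rdiv Rmult_assoc Rinv_l; lra].
  have f6 : 0.01 / INR r * (0.08 ^ r.-1 * (INR r ^ r.-1 / INR (r.-1)`!)) <= 0.01.
    by apply: Rle_trans (Rmult_le_compat_l _ _ _ (Rlt_le _ _ f5.1) f4) _; lra.
  have := exp_le_3; have := exp_pos 1; nra.
- move=> m mr; have mr' : (m < r)%nat by lia.
  apply: Rle_trans (term m h mr' (Rle_refl _)) _.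
  have f1 : 1 <= INR m`! by apply: (INR_leq (a := 1)); apply: fact_gt0.
  have c1 : (0.01 * P / INR r) ^ m.+1 <= P ^ m.+1.
    apply: pow_incr; split.
      by apply: Rmult_le_pos; [lra | apply/Rlt_le/Rinv_0_lt_compat; lra].
    by apply: (Rmult_le_reg_r (INR r)); [lra | rewrite /Rdiv Rmult_assoc Rinv_l; nra].
  have c2 : (8 * INR r ^ 2 * (y / INR n)) ^ m <= exp (8 * s ^ 6) * exp (- (INR m * Lam)).
    rewrite Rpow_mult_distr ynL pow_exp (_ : INR m * - Lam = - (INR m * Lam)); last ring.
    apply: Rmult_le_compat_r; first by apply/Rlt_le/exp_pos.
    apply: Rle_trans (_ : exp (8 * INR r ^ 2) ^ m <= _).
      apply: pow_incr; split; first by have := pow_le (INR r) 2; lra.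
      by have := exp_ineq1_le (8 * INR r ^ 2); lra.
    rewrite pow_exp; apply: exp_le.
    have mr2 : INR m <= s ^ 2 by have := INR_leq (ltnW mr'); lra.
    have rr : INR r ^ 2 <= s ^ 4.
      have -> : s ^ 4 = (s ^ 2) ^ 2 by ring.
      by apply: pow_incr; lra.
    have -> : 8 * s ^ 6 = s ^ 2 * (8 * s ^ 4) by ring.
    apply: Rmult_le_compat; try lra; first exact: pos_INR.
    by have := pow_le (INR r) 2; lra.
  have c3 : INR n * (2 * INR h) / INR kap <= 20 * s ^ 7.
    have -> : INR n * (2 * INR h) / INR kap = 2 * INR n * (INR h / INR kap) by field; lra.
    apply: Rle_trans (_ : 2 * INR n * (5 * (INR r * delta)) <= _).
      by apply: Rmult_le_compat_l; lra.
    have -> : 2 * INR n * (5 * (INR r * delta)) = 10 * (INR r * (delta * INR n)) by ring.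
    have -> : 20 * s ^ 7 = 10 * (s ^ 2 * (2 * s ^ 5)) by ring.
    apply: Rmult_le_compat_l; first lra.
    by apply: Rmult_le_compat; nra.
  apply: Rle_trans (_ : P ^ m.+1 * exp (20 * s ^ 7 + 1) * (exp (8 * s ^ 6) * exp (- (INR m * Lam))) <= _).
    set X := (_ * _ * _).
    have X0 : 0 <= X.
      apply: Rmult_le_pos; last by apply: pow_le; apply: Rmult_le_pos; have := pow_le (INR r) 2; lra.
      apply: Rmult_le_pos; last by apply/Rlt_le/exp_pos.
      by apply: pow_le; apply: Rmult_le_pos; [lra | apply/Rlt_le/Rinv_0_lt_compat; lra].
    apply: Rle_trans (_ : X <= _).
      by apply: (Rmult_le_reg_r (INR m`!)); [lra | rewrite /Rdiv Rmult_assoc Rinv_l; nra].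
    apply: Rmult_le_compat => //.
    + apply: Rmult_le_pos; last by apply/Rlt_le/exp_pos.
      by apply: pow_le; apply: Rmult_le_pos; [lra | apply/Rlt_le/Rinv_0_lt_compat; lra].
    + by apply: pow_le; apply: Rmult_le_pos; have := pow_le (INR r) 2; lra.
    + apply: Rmult_le_compat => //.
      * by apply: pow_le; apply: Rmult_le_pos; [lra | apply/Rlt_le/Rinv_0_lt_compat; lra].
      * by apply/Rlt_le/exp_pos.
      * by apply: exp_le; lra.
  (* With [m + 1] edges and [m] junctions, [Lam] gets the coefficient [(r - m - 1) / r], which is
     largest at [m = 0]. *)
  rewrite PE pow_exp -!exp_plus; apply: exp_le; rewrite S_INR.
  have -> : (INR m + 1) * ((INR r - 1) / INR r * Lam) + (20 * s ^ 7 + 1) +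
      (8 * s ^ 6 + - (INR m * Lam))
    = Lam * ((INR r - (INR m + 1)) / INR r) + 20 * s ^ 7 + 8 * s ^ 6 + 1 by field; lra.
  have m0 := pos_INR m.
  have d1 : (INR r - (INR m + 1)) / INR r <= 1 - / INR r.
    apply: (Rmult_le_reg_r (INR r)); first lra.
    have -> : (1 - / INR r) * INR r = INR r - 1 by field; lra.
    by rewrite /Rdiv Rmult_assoc Rinv_l; lra.
  have d2 : Lam * ((INR r - (INR m + 1)) / INR r) <= Lam * (1 - / INR r).
    by apply: Rmult_le_compat_l.
  have d3 : 0 <= 1 - / INR r.
    have : / INR r <= / 2 by apply: Rinv_le_contravar; lra.
    lra.
  have d4 : Lam * (1 - / INR r) <= y * (1 - / INR r) by apply: Rmult_le_compat_r.
  have d5 : s ^ 8 <= y * / INR r.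
    apply: (Rmult_le_reg_r (INR r)); first lra.
    rewrite Rmult_assoc Rinv_l; last lra.
    rewrite Rmult_1_r /y (_ : s ^ 10 = s ^ 8 * s ^ 2); last ring.
    by apply: Rmult_le_compat_l; [have := s_ge1 8; lra | lra].
  by rewrite -/y; lra.
- by apply/Rlt_le/exp_pos.
- have t1 : 2 * (delta * INR #|V|) <= INR T.+1.
    apply: (Rmult_le_reg_r (2 * INR K)); first lra.
    have := INR_leq (ltnW T2); rewrite !INR_muln [INR 2]/= => le.
    apply: Rle_trans (_ : INR h * INR #|V| <= _); last by lra.
    have := Rmult_le_compat_r _ _ _ (Rlt_le _ _ N0) h1; lra.
  have t2 : INR r * INR n <= 2 * s ^ 5 * (delta * INR #|V|).
    have := Rmult_le_compat_r (delta * INR #|V|) _ _ _ dn; rewrite -dsq.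
    have : 0 <= delta * INR #|V| by apply: Rmult_le_pos; lra.
    move=> p /(_ p); lra.
  have s5 := s_ge1 5.
  (* For [s >= 100] the saving [s ^ 8] outweighs [28 * s ^ 7 + 8 * s ^ 6 + 1]. *)
  have w1 : 8 * s ^ 7 * W <= INR n.
    rewrite n_def; apply: Rle_trans (_ : exp (8 * s ^ 7) * W <= _).
      apply: Rmult_le_compat_r; first by apply/Rlt_le/exp_pos.
      by have := exp_ineq1_le (8 * s ^ 7); lra.
    rewrite -exp_plus; apply: exp_le.
    have := spowS 7; have := spowS 6; have := s_ge1 6; lra.
  have W0 : 0 < W by apply: exp_pos.
  apply: Rle_trans (_ : INR r * (s ^ 2 * W) <= _).
    rewrite /= Rmult_1_r Rmult_assoc; apply: Rmult_le_compat_l; first lra.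
    by apply: Rmult_le_compat_r; lra.
  apply: (Rmult_le_reg_r (8 * s ^ 5)); first lra.
  have -> : INR r * (s ^ 2 * W) * (8 * s ^ 5) = INR r * (8 * s ^ 7 * W) by ring.
  apply: Rle_trans (_ : INR r * INR n <= _); first by apply: Rmult_le_compat_l; lra.
  have := Rmult_le_compat_l (s ^ 5) _ _ _ t1; lra.
- by lia.
- rewrite DE.
  have g1 : INR h * INR #|V| / 2 <= INR h * INR #|V| - INR K * INR T by lra.
  apply: Rle_trans (pow_incr _ _ 2 (conj _ g1)); last by lra.
  have g2 : 4 * (INR r * delta * INR kap) * (4 * (INR r * delta * INR kap)) <= INR h * INR h.
    by apply: Rmult_le_compat; lra.
  have g3 := Rmult_le_compat_r (INR #|V| * INR #|V|) _ _ _ g2.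
  have -> : 4 * INR r * INR #|V| * INR K ^ 2
     = / 4 * (4 * (INR r * delta * INR kap) * (4 * (INR r * delta * INR kap)) * (INR #|V| * INR #|V|)).
    transitivity (4 * (delta * delta * INR #|V|) * INR #|V| * (INR r * INR kap) ^ 2).
      by rewrite dsq KE.
    by field.
  have : 0 <= INR #|V| * INR #|V| by nra.
  move=> /g3; lra.
- by lia.
Qed.

End LargeCase.

(** Without edges any balanced coloring works. Otherwise the two methods meet at
    [4 * ln n * #|V| = r * n ^ 2]. *)
Lemma equitable_coloring_large_n (n r : nat) (V : finType) (E : {set {set V}}) :
  exp (100 ^ 10) <= INR n -> (0 < r)%nat ->
  INR r < Rpower (ln (INR n)) (1 / 5) -> uniform n E ->
  INR #|E| <= 0.01 * Rpower (INR n / ln (INR n)) ((INR r - 1) / INR r) * INR r ^ (n - 1) ->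
  (r %| #|V|)%nat -> exists f : V -> 'I_r, equitable_coloring E f.
Proof.
move=> ne r0 rlt Eu cE rV.
pose M := (#|V| %/ r)%nat.
have cV : #|V| = (r * M)%nat by rewrite mulnC divnK.
case: (set_0Vmem E) => [E0|[e eE]].
  have [c cM] := balanced_coloring_exists cV; exists c; split=> [e|i j].
    by rewrite E0 inE.
  by rewrite /color_class !cM addn1 leqnSn.
have E1 : 1 <= INR #|E| by apply: (INR_leq (a := 1)); apply/card_gt0P; exists e.
have n_pos : 0 < INR n by apply: Rlt_le_trans (exp_pos _) ne.
have y100 : 100 ^ 10 <= ln (INR n).
  apply: Rnot_lt_le => /exp_increasing; rewrite exp_ln //; lra.
have y0 : 0 < ln (INR n) by apply: Rlt_le_trans y100; apply: pow_lt; lra.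
pose s := Rpower (ln (INR n)) (/ 10).
have sP k : s ^ k = Rpower (ln (INR n)) (/ 10 * INR k).
  by rewrite -Rpower_pow; [rewrite /s Rpower_mult | apply: exp_pos].
have s10 : s ^ 10 = ln (INR n).
  rewrite sP (_ : / 10 * INR 10 = 1) ?Rpower_1 //; rewrite /=; lra.
have s2 : s ^ 2 = Rpower (ln (INR n)) (1 / 5).
  by rewrite sP; congr Rpower; rewrite /=; lra.
have s0 : 0 < s by apply: exp_pos.
have s100 : 100 <= s.
  apply: Rnot_lt_le => lt.
  have h9 : s ^ 9 <= 100 ^ 9 by apply: pow_incr; lra.
  have p9 : 0 < 100 ^ 9 by apply: pow_lt; lra.
  move: y100; rewrite -s10 -[100 ^ 10]tech_pow_Rmult -[s ^ 10]tech_pow_Rmult; nra.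
(* For [r = 1] the bound on the number of edges is [0.01], although there is an edge. *)
have r1 : (1 < r)%nat.
  rewrite ltn_neqAle r0 andbT; apply/eqP => r_eq1; move: cE.
  rewrite -r_eq1 [INR 1]/= Rminus_diag /Rdiv Rmult_0_l Rpower_O ?pow1; last first.
    by apply: Rmult_lt_0_compat => //; apply: Rinv_0_lt_compat.
  lra.
have nE : INR n = exp (s ^ 10) by rewrite s10 exp_ln.
case: (Rle_lt_dec (4 * ln (INR n) * INR #|V|) (INR r * INR n ^ 2)) => [small|large].
  apply: (first_moment_coloring Eu cV); rewrite cV.
  have y1 : 1 <= ln (INR n) by apply: Rle_trans y100; apply: pow_R1_Rle; lra.
  apply: first_moment_small => //.
  - by apply: (n_gt1 s100 nE).
  - by rewrite -cV -(Eu e eE); apply: max_card.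
  - by rewrite -cV.
apply: (large_case_coloring s100 nE r1 _ Eu cV); rewrite ?s10 //.
by rewrite s2.
Qed.

End Estimates.

Theorem theorem1 :
  exists n0 : nat, forall n : nat, (n0 <= n)%N ->
  forall r : nat, (0 < r)%N ->
  (INR r < Rpower (ln (INR n)) (1 / 5))%R ->
  forall (V : finType) (E : {set {set V}}),
    uniform n E ->
    (INR #|E| <= 0.01 * Rpower (INR n / ln (INR n)) ((INR r - 1) / INR r)
                   * INR r ^ (n - 1))%R ->
    (r %| #|V|)%N ->
    exists f : V -> 'I_r, equitable_coloring E f.
Proof.
have [n0 [n0e _]] := @nat_between (exp (100 ^ 10)) (exp (100 ^ 10) + 1)
  (Rlt_le _ _ (exp_pos _)) (Rle_refl _).
exists n0 => n nn0 r r0 rlt V E Eu cE rV.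
apply: equitable_coloring_large_n r0 rlt Eu cE rV.
by apply: Rle_trans n0e _; apply: INR_leq.
Qed.
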